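(* Let $M\ge1$, $\varepsilon>0$, $\Omega>0$, $T=2\pi/\Omega$, $\lambda_l\in\mathbb{C}$ with $\mathrm{Re}(\lambda_l)<0<\mathrm{Im}(\lambda_l)$, $\beta_1,\dots,\beta_M\in\mathbb{C}$ and $r\in\mathbb{R}$, $r\neq0$. Consider the reduced dynamics $$\dot z_l=\lambda_lz_l+\sum_{m=1}^M\beta_m z_l^{m+1}\overline{z}_l^{m}+i\,\varepsilon\,r\,e^{i\Omega t}$$ (together with its complex conjugate) on the time-dependent spectral submanifold $W(E_l)$, write $z_l=\rho e^{i\theta}$ with $\rho>0$, and set $$a(\rho)=\mathrm{Re}(\lambda_l)\rho+\sum_{m=1}^M\mathrm{Re}(\beta_m)\rho^{2m+1},\qquad b(\rho)=\mathrm{Im}(\lambda_l)+\sum_{m=1}^M\mathrm{Im}(\beta_m)\rho^{2m}.$$ Then the following hold for the $T$-periodic orbits of the reduced dynamics. (i) Amplitude of the periodic response: the amplitudes $\rho$ of the $T$-periodic orbits are given by the zeros of the equation $$f(\rho,\Omega):=[a(\rho)]^2+[b(\rho)-\Omega]^2\rho^2-\varepsilon^2r^2 .$$ (ii) Phase shift of the periodic response: for a given amplitude $\rho$ of the periodic response, the phase shift $\psi$ between the $T$-periodic orbit and the external forcing is $$\psi=\arccos\left(\frac{[\Omega-b(\rho)]\rho}{\varepsilon r}\right).$$ (iii) Stability of the periodic response: the stability of the $T$-periodic response with amplitude $\rho$ is determined by the eigenvalues of the Jacobian $$\mathbf{J}(\rho)=\begin{bmatrix}\dfrac{\partial a(\rho)}{\partial\rho}&[\Omega-b(\rho)]\rho\\[2mm]\dfrac{\partial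 b(\rho)}{\partial\rho}-\dfrac{\Omega-b(\rho)}{\rho}&\dfrac{a(\rho)}{\rho}\end{bmatrix}.$$
   Context: The reduced dynamics is the truncated (leading-order) dynamics on the two-dimensional spectral submanifold $W(E_l)$ (the smoothest invariant manifold of the system continuing the modal subspace $E_l$ spanned by the eigenvectors of a complex conjugate eigenvalue pair $\lambda_l,\overline{\lambda}_l$ of the linearization) of a damped nonlinear mechanical system with forcing $\varepsilon\mathbf{f}_{ext}=\varepsilon\mathbf{f}\cos(\Omega t)$; $z_l$ is the complex coordinate on $W(E_l)$, $\beta_m$ are the coefficients of the autonomous reduced dynamics, and the forcing coefficient $r_c=ir$ (the component of the forcing vector falling in $E_l$) is purely imaginary (after normalizing eigenvectors), with $r=\mathrm{Im}(r_c)$. The $T$-periodic orbits in question are the steady-state responses with constant amplitude $\rho>0$ and constant phase shift $\psi=\theta-\Omega t$, i.e. $z_l(t)=\rho e^{i(\Omega t+\psi)}$; equivalently, equilibria of the planar system for $(\rho,\psi)$ obtained from the reduced dynamics by the change of variables $z_l=\rho e^{i\theta}$, $\psi=\theta-\Omega t$. Stability ''determined by the eigenvalues of the Jacobian'' is meant in the sense of linearization: $\mathbf{J}(\rho)$ is the Jacobian matrix, with respect to $(\rho,\psi)$, of this planar system at the corresponding equilibrium.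
   Formalization: In (ii) the phase is taken modulo 2π and equals +arccos(...) when a(ρ)r ≤ 0 but −arccos(...) when a(ρ)r ≥ 0; the formula with the principal arccos alone fails e.g. for β=0 and r<0. *)

(* Defs.v *)
From Stdlib Require Export Reals.
From Coquelicot Require Export Coquelicot.
Open Scope R_scope.

(* [cis x] is e^{i x}. *)
Definition cis (x : R) : C := (cos x, sin x).

(* Right-hand side g t z of the reduced dynamics z' = g t z.  Only
   beta 1, ..., beta M are used. *)
Definition reduced_field (M : nat) (eps Omega : R) (lambda : C)
    (beta : nat -> C) (r : R) (t : R) (z : C) : C :=
  (lambda * z
   + sum_n_m (fun m => beta m * Cpow z (m + 1) * Cpow (Cconj z) m) 1 M
   + Ci * RtoC eps * RtoC r * cis (Omega * t))%C.

Definition a_fun (M : nat) (lambda : C) (beta : nat -> C) (rho : R) : R :=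
  Re lambda * rho + sum_n_m (fun m => Re (beta m) * rho ^ (2 * m + 1)) 1 M.

Definition b_fun (M : nat) (lambda : C) (beta : nat -> C) (rho : R) : R :=
  Im lambda + sum_n_m (fun m => Im (beta m) * rho ^ (2 * m)) 1 M.

Definition f_fun (M : nat) (eps : R) (lambda : C) (beta : nat -> C) (r : R)
    (rho Omega : R) : R :=
  a_fun M lambda beta rho ^ 2
  + (b_fun M lambda beta rho - Omega) ^ 2 * rho ^ 2
  - eps ^ 2 * r ^ 2.

Definition J_mat (M : nat) (Omega : R) (lambda : C) (beta : nat -> C)
    (rho : R) : matrix 2 2 :=
  let a := a_fun M lambda beta in
  let b := b_fun M lambda beta in
  [ [ Derive a rho, (Omega - b rho) * rho ],
    [ Derive b rho - (Omega - b rho) / rho, a rho / rho ] ].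

(* Solutions on [t0, t1).  The derivative is two-sided also at t0; this is no
   restriction, since z is a total function and a solution on [t0, t1) can be
   extended affinely to the left of t0. *)
Definition solution_on (g : R -> C -> C) (z : R -> C) (t0 : R) (t1 : Rbar)
    : Prop :=
  forall t : R, t0 <= t -> Rbar_lt t t1 ->
    is_derive (V := C_R_NormedModule) z t (g t (z t)).

Definition periodic_orbit (g : R -> C -> C) (T : R) (z : R -> C) : Prop :=
  (forall t : R, is_derive (V := C_R_NormedModule) z t (g t (z t))) /\
  (forall t : R, z (t + T) = z t).

Definition response (Omega rho psi : R) (t : R) : C :=
  (RtoC rho * cis (Omega * t + psi))%C.

Definition periodic_response (g : R -> C -> C) (Omega T rho psi : R) : Prop :=
  0 < rho /\ periodic_orbit g T (response Omega rho psi).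

(* (F, G) is the planar system rho' = F rho psi, psi' = G rho psi obtained from
   z' = g t z by the change of variables z = rho e^{i (Omega t + psi)}. *)
Definition polar_system (g : R -> C -> C) (Omega : R) (F G : R -> R -> R)
    : Prop :=
  forall (rho psi : R -> R) (t : R),
    0 < rho t -> ex_derive rho t -> ex_derive psi t ->
    let z := fun s : R => response Omega (rho s) (psi s) s in
    is_derive (V := C_R_NormedModule) z t (g t (z t)) <->
    (is_derive rho t (F (rho t) (psi t)) /\
     is_derive psi t (G (rho t) (psi t))).

(* Total (Frechet) differentiability of both components, with the entries of A
   as partial derivatives. *)
Definition is_jacobian (F G : R -> R -> R) (x y : R) (A : matrix 2 2) : Prop :=
  differentiable_pt_lim F x y (coeff_mat 0 A 0 0) (coeff_mat 0 A 0 1) /\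
  differentiable_pt_lim G x y (coeff_mat 0 A 1 0) (coeff_mat 0 A 1 1).

(* Complex eigenvalues of a real matrix. *)
Definition is_eigenvalue (A : matrix (T := R) 2 2) (mu : C) : Prop :=
  let AC : matrix 2 2 :=
    mk_matrix 2 2 (fun i j => RtoC (coeff_mat 0 A i j)) in
  exists v : matrix (T := C) 2 1,
    v <> zero /\
    Mmult (T := C_Ring) AC v
    = mk_matrix 2 1 (fun i j => (mu * coeff_mat (RtoC 0) v i j)%C).

(* Lyapunov stability of a solution zs.  Competing solutions are tested on
   every bounded interval [t0, t1), so those with finite lifetime count too. *)
Definition lyapunov_stable (g : R -> C -> C) (zs : R -> C) : Prop :=
  forall (t0 : R) (e : posreal), exists d : posreal,
    forall (z : R -> C) (t1 : R),
      solution_on g z t0 t1 ->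
      Cmod (z t0 - zs t0)%C < d ->
      forall t : R, t0 <= t < t1 -> Cmod (z t - zs t)%C < e.

Definition asymptotically_stable (g : R -> C -> C) (zs : R -> C) : Prop :=
  lyapunov_stable g zs /\
  forall t0 : R, exists d : posreal,
    forall z : R -> C,
      solution_on g z t0 p_infty ->
      Cmod (z t0 - zs t0)%C < d ->
      is_lim (fun t => Cmod (z t - zs t)%C) p_infty 0.

(* Main.v *)
Require Import Defs.
From Stdlib Require Import Reals Lra Lia Psatz ClassicalEpsilon.
From Coquelicot Require Import Coquelicot.
Open Scope R_scope.

(** Every nonlinear term beta_m z^(m+1) conj(z)^m equals
    beta_m |z|^(2m) z, so the autonomous part of the field is
    c(|z|^2) z for a complex-valued real polynomial c, with
    rho c(rho^2) = a(rho) + i rho b(rho).  In a frame that rotates with the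
    forcing, z = w e^{i (Omega t + psi)}, the time therefore no longer appears
    explicitly ([reduced_field_rotating]):
      w' = c(|w|^2) w - i (Omega + psi') w + eps r (sin psi + i cos psi).
    A response of constant amplitude and phase is a real constant w = rho,
    hence a solution of a(rho) + eps r sin psi = 0 and
    (b(rho) - Omega) rho + eps r cos psi = 0.  Eliminating psi gives the
    amplitude equation; the second equation gives the cosine of the phase and
    the first one the sign of its sine.  With w = rho(t) and psi = psi(t) the
    same formula is the planar system for amplitude and phase.

    Stability is studied in the Cartesian coordinate u = w - rho, because
    |u(t)| is exactly the distance between a solution and the response and
    no angle has to be lifted.  The linearisation at u = 0 is conjugate to
    J(rho) by diag(1, rho), so both have the same trace and determinant.  For
    a real 2x2 matrix A the form V(u) = det A |u|^2 + |adj A u|^2 has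
    derivative 2 tr A det A |u|^2 along u' = A u.  If all eigenvalues have
    negative real part then tr A < 0 < det A, V is positive definite and it
    decays exponentially along the nonlinear flow too
    ([exponential_attraction]).  If some eigenvalue has positive real part
    then for a suitable k >= 0 the form V built from A - k satisfies
    V' = 2 k V + c |u|^2 with c > 0 along the linear flow and is positive
    somewhere; a solution that starts with V > 0 then has V growing
    exponentially and cannot stay near 0 ([planar_unstable]).

    Instability needs solutions that live long enough to escape.  They come
    from the Picard-Lindelof theorem ([picard_lindelof]), applied to the
    field frozen outside a box, which is bounded and globally Lipschitz. *)

(** * The Picard-Lindelof theorem *)

Lemma filterlim_of_norm_bound (V : NormedModule R_AbsRing) (f : nat -> V)
    (l : V) (e : nat -> R) :
  (forall n, norm (minus (f n) l) <= e n) -> is_lim_seq e 0 ->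
  filterlim f eventually (locally l).
Proof.
  intros Hf He.
  apply filterlim_locally; intros eps.
  apply is_lim_seq_spec in He; destruct (He eps) as [N HN].
  exists N; intros n Hn.
  apply norm_compat1.
  apply Rle_lt_trans with (1 := Hf n).
  specialize (HN n Hn); rewrite Rminus_0_r in HN.
  apply Rabs_def2 in HN; apply HN.
Qed.

Lemma norm_limit_le (V : NormedModule R_AbsRing) (f g : nat -> V)
    (l m : V) (B : R) :
  filterlim f eventually (locally l) -> filterlim g eventually (locally m) ->
  eventually (fun n => norm (minus (f n) (g n)) <= B) ->
  norm (minus l m) <= B.
Proof.
  intros Hf Hg HB.
  assert (H : filterlim (fun n => norm (minus (f n) (g n))) eventually
                (Rbar_locally (norm (minus l m)))).
  { apply (filterlim_comp _ _ _ (fun n => minus (f n) (g n)) norm _ _ _)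
      with (2 := filterlim_norm _).
    apply (filterlim_comp_2 (G := locally l) (H := locally (opp m))
             f (fun n => opp (g n)) plus); [exact Hf | | apply filterlim_plus].
    apply filterlim_comp with (1 := Hg), filterlim_opp. }
  exact (filterlim_le (fun n => norm (minus (f n) (g n))) (fun _ => B)
    (norm (minus l m)) B HB H (filterlim_const B)).
Qed.

Lemma lipschitz_continuous (U V : NormedModule R_AbsRing) (f : U -> V) (K : R) :
  (forall x y, norm (minus (f x) (f y)) <= K * norm (minus x y)) ->
  forall x, continuous f x.
Proof.
  intros Hf x.
  apply filterlim_locally_ball_norm; intros eps.
  assert (HK : 0 < eps / (Rabs K + 1)).
  { apply Rdiv_lt_0_compat; [apply eps | pose proof (Rabs_pos K); lra]. }
  apply locally_le_locally_norm.
  exists (mkposreal _ HK); intros y Hy.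
  unfold ball_norm in *; simpl in Hy.
  apply Rle_lt_trans with (1 := Hf y x).
  apply Rle_lt_trans with ((Rabs K + 1) * norm (minus y x)).
  - apply Rmult_le_compat_r; [apply norm_ge_0 | ].
    pose proof (Rle_abs K); lra.
  - apply Rlt_le_trans with ((Rabs K + 1) * (eps / (Rabs K + 1))).
    + apply Rmult_lt_compat_l; [pose proof (Rabs_pos K); lra | exact Hy].
    + right; field; pose proof (Rabs_pos K); lra.
Qed.

(** An exponential weight turns the bound on the integrand into the same bound
    divided by the rate [k]; this gain makes the Picard iteration contract. *)
Lemma norm_RInt_exp_le (V : CompleteNormedModule R_AbsRing) (f : R -> V)
    (a b c k : R) :
  a <= b -> 0 <= c ->
  (forall s, continuous f s) ->
  (forall s, a <= s <= b -> norm (f s) <= c * k * exp (k * (s - a))) ->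
  norm (RInt f a b) <= c * exp (k * (b - a)).
Proof.
  intros Hab Hc Hf Hle.
  apply Rle_trans with (c * exp (k * (b - a)) - c * exp (k * (a - a))).
  - apply (norm_RInt_le f (fun s => c * k * exp (k * (s - a))) a b).
    + exact Hab.
    + exact Hle.
    + apply RInt_correct, ex_RInt_continuous; intros; apply Hf.
    + apply (is_RInt_derive (fun s => c * exp (k * (s - a)))).
      * intros s _; auto_derive; [easy | unfold Rminus; ring].
      * intros s _; apply (ex_derive_continuous (V := R_NormedModule)).
        auto_derive; easy.
  - assert (0 <= c * exp (k * (a - a))).
    { apply Rmult_le_pos; [exact Hc | left; apply exp_pos]. }
    lra.
Qed.

Lemma minus_plus_plus_l (G : AbelianGroup) (x y z : G) :
  minus (plus x y) (plus x z) = minus y z.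
Proof.
  unfold minus.
  rewrite opp_plus, (plus_comm x), <- plus_assoc, (plus_assoc x).
  now rewrite plus_opp_r, plus_zero_l.
Qed.

Lemma norm_minus_diag (V : CompleteNormedModule R_AbsRing) (x : V) :
  norm (minus x x) <= 0.
Proof.
  rewrite minus_eq_zero; right; apply @norm_zero.
Qed.

Lemma norm_minus_triangle (V : CompleteNormedModule R_AbsRing) (x y z : V) :
  norm (minus x z) <= norm (minus x y) + norm (minus y z).
Proof.
  rewrite (minus_trans y); apply @norm_triangle.
Qed.

Definition integral_from {V : CompleteNormedModule R_AbsRing} (t0 : R) (u0 : V)
    (f : R -> V) (t : R) : V :=
  plus u0 (RInt f t0 t).

Lemma is_derive_integral_from (V : CompleteNormedModule R_AbsRing) (t0 : R)
    (u0 : V) (f : R -> V) :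
  (forall s, continuous f s) ->
  forall t, is_derive (integral_from t0 u0 f) t (f t).
Proof.
  intros Hf t.
  replace (f t) with (plus zero (f t)) by apply plus_zero_l.
  apply @is_derive_plus.
  - apply @is_derive_const.
  - apply (is_derive_RInt f (RInt f t0) t0); [ | apply Hf].
    apply filter_forall; intros s.
    apply RInt_correct, ex_RInt_continuous; intros; apply Hf.
Qed.

Lemma minus_integral_from (V : CompleteNormedModule R_AbsRing) (t0 : R)
    (u0 : V) (f g : R -> V) (t : R) :
  (forall s, continuous f s) -> (forall s, continuous g s) ->
  minus (integral_from t0 u0 f t) (integral_from t0 u0 g t)
  = RInt (fun s => minus (f s) (g s)) t0 t.
Proof.
  intros Hf Hg.
  symmetry; etransitivity.
  { apply (RInt_minus f g); apply ex_RInt_continuous; auto. }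
  symmetry; apply minus_plus_plus_l.
Qed.

Lemma integral_from_lipschitz (V : CompleteNormedModule R_AbsRing) (t0 : R)
    (u0 : V) (f : R -> V) (B : R) :
  (forall s, continuous f s) -> (forall s, norm (f s) <= B) ->
  forall t s,
    norm (minus (integral_from t0 u0 f t) (integral_from t0 u0 f s))
    <= B * Rabs (t - s).
Proof.
  intros Hf HB t s.
  rewrite Rmult_comm.
  apply (norm_RInt_le_const_abs f s t); [intros; apply HB | ].
  apply (is_RInt_derive (integral_from t0 u0 f)).
  - intros; now apply is_derive_integral_from.
  - intros; apply Hf.
Qed.

Lemma norm_minus_integral_from_le (V : CompleteNormedModule R_AbsRing)
    (f g : R -> V) (u0 : V) (a b c k : R) :
  a <= b -> 0 <= c ->
  (forall s, continuous f s) -> (forall s, continuous g s) ->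
  (forall s, a <= s <= b ->
     norm (minus (f s) (g s)) <= c * k * exp (k * (s - a))) ->
  norm (minus (integral_from a u0 f b) (integral_from a u0 g b))
  <= c * exp (k * (b - a)).
Proof.
  intros Hab Hc Hf Hg Hle.
  rewrite minus_integral_from by assumption.
  apply norm_RInt_exp_le; [exact Hab | exact Hc | | exact Hle].
  intros s; apply (continuous_minus (V := V) f g); auto.
Qed.

(** Extending the integrand from [t0, +oo) to the whole line by its value at
    [t0] makes every iterate differentiable at [t0] from both sides. *)
Fixpoint picard {V : CompleteNormedModule R_AbsRing} (h : V -> V) (t0 : R)
    (u0 : V) (n : nat) : R -> V :=
  match n with
  | O => fun _ => u0
  | S n => integral_from t0 u0 (fun s => h (picard h t0 u0 n (Rmax t0 s)))
  end.

Lemma Rmax_lipschitz (a s t : R) :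
  Rabs (Rmax a s - Rmax a t) <= Rabs (s - t).
Proof.
  unfold Rmax; destruct (Rle_dec a s), (Rle_dec a t);
    unfold Rabs; repeat destruct Rcase_abs; lra.
Qed.

Lemma continuous_delayed (V : CompleteNormedModule R_AbsRing) (h : V -> V)
    (t0 L B : R) (u : R -> V) :
  0 <= L ->
  (forall x y, norm (minus (h x) (h y)) <= L * norm (minus x y)) ->
  (forall s t, t0 <= s -> t0 <= t ->
     norm (minus (u t) (u s)) <= B * Rabs (t - s)) ->
  forall s, continuous (fun s => h (u (Rmax t0 s))) s.
Proof.
  intros HL Hh Hu.
  apply (lipschitz_continuous R_NormedModule V) with (L * Rabs B).
  intros s t.
  apply Rle_trans with (1 := Hh _ _).
  rewrite Rmult_assoc; apply Rmult_le_compat_l; [exact HL | ].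
  apply Rle_trans with (1 := Hu _ _ (Rmax_l _ _) (Rmax_l _ _)).
  apply Rle_trans with (Rabs B * Rabs (Rmax t0 s - Rmax t0 t)).
  - apply Rmult_le_compat_r; [apply Rabs_pos | apply Rle_abs].
  - apply Rmult_le_compat_l; [apply Rabs_pos | ].
    apply Rmax_lipschitz.
Qed.

(** Measured with the weight exp (k (t - t0)), k twice a Lipschitz constant,
    consecutive Picard iterates approach each other by a factor 1/2, so they
    converge for every t >= t0 without any smallness condition on the time
    interval.  All iterates are Lipschitz in time with constant [B], hence so
    is the limit, and the limit is a fixed point of the iteration. *)
Theorem picard_lindelof (V : CompleteNormedModule R_AbsRing) (h : V -> V)
    (L B : R) :
  (forall x y, norm (minus (h x) (h y)) <= L * norm (minus x y)) ->
  (forall x, norm (h x) <= B) ->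
  forall (t0 : R) (u0 : V), exists u : R -> V,
    u t0 = u0 /\ forall t, t0 <= t -> is_derive u t (h (u t)).
Proof.
  intros Hh' HB t0 u0.
  (* the summand 1 keeps the rate positive when L = 0 *)
  set (k := 2 * (Rabs L + 1)).
  assert (Hk : 0 < k) by (unfold k; pose proof (Rabs_pos L); lra).
  assert (Hh : forall x y,
    norm (minus (h x) (h y)) <= k / 2 * norm (minus x y)).
  { intros x y; apply Rle_trans with (1 := Hh' x y).
    apply Rmult_le_compat_r; [apply norm_ge_0 | ].
    unfold k; pose proof (Rle_abs L); lra. }
  assert (HB0 : 0 <= B).
  { apply Rle_trans with (2 := HB u0), norm_ge_0. }
  set (p := picard h t0 u0).
  set (c := B / k).
  assert (Hc : 0 <= c) by (apply Rdiv_le_0_compat; assumption).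
  assert (Hplip : forall n s t,
    norm (minus (p n t) (p n s)) <= B * Rabs (t - s)).
  { induction n as [ | n IH]; intros s t.
    - apply Rle_trans with 0; [apply norm_minus_diag | ].
      apply Rmult_le_pos; [exact HB0 | apply Rabs_pos].
    - apply integral_from_lipschitz; [ | intros; apply HB].
      apply continuous_delayed with (k / 2) B; [lra | exact Hh | ].
      intros; apply IH. }
  assert (Hpc : forall n s, continuous (fun s => h (p n (Rmax t0 s))) s).
  { intros n; apply continuous_delayed with (k / 2) B; [lra | exact Hh | ].
    intros; apply Hplip. }
  assert (Hstep : forall n t, t0 <= t ->
    norm (minus (p (S n) t) (p n t)) <= c * (1 / 2) ^ n * exp (k * (t - t0))).
  { induction n as [ | n IH]; intros t Ht.
    - apply Rle_trans with (B * Rabs (t - t0)).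
      + apply Rle_trans with (2 := Hplip 1%nat t0 t); right.
        do 2 f_equal; unfold p; simpl; unfold integral_from.
        now rewrite RInt_point, plus_zero_r.
      + rewrite Rabs_pos_eq by lra.
        replace (B * (t - t0)) with (c * (k * (t - t0)))
          by (unfold c; field; lra).
        rewrite pow_O, Rmult_1_r; apply Rmult_le_compat_l; [exact Hc | ].
        pose proof (exp_ineq1_le (k * (t - t0))); lra.
    - change (p (S (S n)))
        with (integral_from t0 u0 (fun s => h (p (S n) (Rmax t0 s)))).
      change (p (S n) t)
        with (integral_from t0 u0 (fun s => h (p n (Rmax t0 s))) t).
      apply norm_minus_integral_from_le; try apply Hpc.
      + exact Ht.
      + apply Rmult_le_pos; [exact Hc | apply pow_le; lra].
      + intros s Hs.
        apply Rle_trans with (1 := Hh _ _).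
        rewrite Rmax_right by apply Hs.
        apply Rle_trans
          with (k / 2 * (c * (1 / 2) ^ n * exp (k * (s - t0)))).
        * apply Rmult_le_compat_l; [lra | apply IH, Hs].
        * right; simpl; field. }
  assert (Htail : forall j n t, t0 <= t ->
    norm (minus (p (n + j)%nat t) (p n t))
    <= 2 * c * (1 / 2) ^ n * (1 - (1 / 2) ^ j) * exp (k * (t - t0))).
  { induction j as [ | j IH]; intros n t Ht.
    - rewrite Nat.add_0_r.
      apply Rle_trans with (1 := norm_minus_diag _ _); simpl; lra.
    - rewrite Nat.add_succ_r.
      apply Rle_trans with (1 := norm_minus_triangle _ _ (p (n + j)%nat t) _).
      apply Rle_trans
        with (1 := Rplus_le_compat _ _ _ _ (Hstep _ t Ht) (IH n t Ht)).
      right; rewrite pow_add; simpl; field. }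
  assert (Hgeom : forall K : R, is_lim_seq (fun n => K * (1 / 2) ^ n) 0).
  { intros K; replace (Finite 0) with (Rbar_mult K 0)
      by (simpl; f_equal; ring).
    apply is_lim_seq_scal_l, is_lim_seq_geom; rewrite Rabs_pos_eq; lra. }
  assert (Hlim : forall t, exists l : V,
    t0 <= t -> filterlim (fun n => p n t) eventually (locally l)).
  { intros t; destruct (Rle_dec t0 t) as [Ht | Ht].
    2:{ exists u0; intros; contradiction. }
    destruct (proj1 (filterlim_locally_cauchy (F := eventually)
      (fun n => p n t))) as [l Hl]; [ | exists l; auto].
    intros eps.
    pose proof (Hgeom (2 * c * exp (k * (t - t0)))) as He.
    apply is_lim_seq_spec in He; destruct (He (pos_div_2 eps)) as [N HN].
    specialize (HN N (Nat.le_refl N)); rewrite Rminus_0_r in HN.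
    apply Rabs_def2 in HN; destruct HN as [HN _]; simpl in HN.
    assert (Hball : forall n, (N <= n)%nat ->
      norm (minus (p n t) (p N t)) < eps / 2).
    { intros n Hn; replace n with (N + (n - N))%nat by lia.
      apply Rle_lt_trans with (1 := Htail _ _ _ Ht).
      apply Rle_lt_trans with (2 := HN).
      assert (0 <= 2 * c * exp (k * (t - t0)) * (1 / 2) ^ N).
      { apply Rmult_le_pos; [ | apply pow_le; lra].
        apply Rmult_le_pos; [lra | left; apply exp_pos]. }
      assert (0 < (1 / 2) ^ (n - N)) by (apply pow_lt; lra).
      nra. }
    exists (le N); split; [now exists N | ].
    intros m n Hm Hn.
    replace (pos eps) with (eps / 2 + eps / 2) by field.
    apply ball_triangle with (p N t).
    - apply ball_sym, (norm_compat1 (V := V)), Hball, Hm.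
    - apply (norm_compat1 (V := V)), Hball, Hn. }
  destruct (choice _ Hlim) as [u Hu].
  assert (Hulip : forall s t, t0 <= s -> t0 <= t ->
    norm (minus (u t) (u s)) <= B * Rabs (t - s)).
  { intros s t Hs Ht.
    apply norm_limit_le with (1 := Hu t Ht) (2 := Hu s Hs).
    now apply filter_forall. }
  assert (Huc : forall s, continuous (fun s => h (u (Rmax t0 s))) s).
  { apply continuous_delayed with (k / 2) B; [lra | exact Hh | exact Hulip]. }
  assert (Hup : forall n t, t0 <= t ->
    norm (minus (u t) (p n t)) <= 2 * c * (1 / 2) ^ n * exp (k * (t - t0))).
  { intros n t Ht.
    apply norm_limit_le with (1 := Hu t Ht) (2 := filterlim_const (p n t)).
    exists n; intros m Hm; replace m with (n + (m - n))%nat by lia.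
    apply Rle_trans with (1 := Htail _ _ _ Ht).
    apply Rmult_le_compat_r; [left; apply exp_pos | ].
    rewrite <- (Rmult_1_r (2 * c * (1 / 2) ^ n)) at 2.
    apply Rmult_le_compat_l.
    - apply Rmult_le_pos; [lra | apply pow_le; lra].
    - assert (0 < (1 / 2) ^ (m - n)) by (apply pow_lt; lra); lra. }
  set (v := integral_from t0 u0 (fun s => h (u (Rmax t0 s)))).
  assert (Hvu : forall t, t0 <= t -> v t = u t).
  { intros t Ht.
    apply (filterlim_locally_unique (F := eventually) (fun n => p (S n) t)).
    2:{ apply (filterlim_comp _ _ _ S (fun n => p n t) _ eventually);
          [apply eventually_subseq; intros; lia | now apply Hu]. }
    apply filterlim_of_norm_bound
      with (fun n => c * exp (k * (t - t0)) * (1 / 2) ^ n); [ | apply Hgeom].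
    intros n.
    change (p (S n) t)
      with (integral_from t0 u0 (fun s => h (p n (Rmax t0 s))) t).
    unfold v.
    replace (c * exp (k * (t - t0)) * (1 / 2) ^ n)
      with (c * (1 / 2) ^ n * exp (k * (t - t0))) by ring.
    apply norm_minus_integral_from_le; auto.
    - apply Rmult_le_pos; [exact Hc | apply pow_le; lra].
    - intros s Hs.
      apply Rle_trans with (1 := Hh _ _).
      rewrite Rmax_right by apply Hs.
      rewrite <- norm_opp, opp_minus.
      apply Rle_trans
        with (k / 2 * (2 * c * (1 / 2) ^ n * exp (k * (s - t0)))).
      + apply Rmult_le_compat_l; [lra | apply Hup, Hs].
      + right; field. }
  exists v; split.
  - unfold v, integral_from; now rewrite RInt_point, plus_zero_r.
  - intros t Ht; rewrite Hvu by exact Ht.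
    replace (u t) with (u (Rmax t0 t)) by now rewrite Rmax_right.
    apply (is_derive_integral_from V t0 u0 (fun s => h (u (Rmax t0 s)))), Huc.
Qed.

(** * Complex-valued functions of a real variable *)

(** Real calculus, including automatic differentiation, becomes available for
    complex-valued functions through this equivalence. *)
Lemma is_derive_C_iff (z : R -> C) (t : R) (l : C) :
  is_derive (V := C_R_NormedModule) z t l <->
  is_derive (fun s => Re (z s)) t (Re l) /\
  is_derive (fun s => Im (z s)) t (Im l).
Proof.
  split.
  - intros H; split.
    + exact (filterdiff_comp' (V := C_R_NormedModule) z (fun u : C => fst u) t
               _ _ H (filterdiff_linear _ is_linear_fst)).
    + exact (filterdiff_comp' (V := C_R_NormedModule) z (fun u : C => snd u) t
               _ _ H (filterdiff_linear _ is_linear_snd)).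
  - intros [H1 H2].
    assert (Hid : filterdiff (U := prod_NormedModule _ R_NormedModule
        R_NormedModule) (V := C_R_NormedModule)
      (fun u : R * R => (fst u, snd u)) (locally (Re (z t), Im (z t)))
      (fun u : R * R => (fst u, snd u))).
    { apply (filterdiff_ext_lin _ (fun u : C_R_NormedModule => u)).
      2:{ intros [x y]; reflexivity. }
      apply (filterdiff_ext (fun u : C_R_NormedModule => u)).
      { intros [x y]; reflexivity. }
      apply filterdiff_id. }
    pose proof (filterdiff_comp'_2 _ _ (fun x y : R => (x, y) : C) t
      _ _ (fun x y : R => (x, y) : C) H1 H2 Hid) as H.
    apply (filterdiff_ext (V := C_R_NormedModule)) with (2 := H).
    intros s; symmetry; apply surjective_pairing.
Qed.

Lemma norm_C_R (z : C) : norm (V := C_R_NormedModule) z = Cmod z.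
Proof.
  change (sqrt (Rabs (fst z) ^ 2 + Rabs (snd z) ^ 2) = Cmod z).
  now rewrite !pow2_abs.
Qed.

Lemma Cmod_sqr (z : C) : Cmod z ^ 2 = Re z ^ 2 + Im z ^ 2.
Proof.
  unfold Cmod; rewrite pow2_sqrt; [reflexivity | ].
  pose proof (pow2_ge_0 (fst z)); pose proof (pow2_ge_0 (snd z)); lra.
Qed.

Lemma Cminus_0_r (z : C) : (z - 0)%C = z.
Proof. ring. Qed.

Lemma Re_le_Cmod (z : C) : Rabs (Re z) <= Cmod z.
Proof. apply Rle_trans with (2 := Rmax_Cmod z), Rmax_l. Qed.

Lemma Im_le_Cmod (z : C) : Rabs (Im z) <= Cmod z.
Proof. apply Rle_trans with (2 := Rmax_Cmod z), Rmax_r. Qed.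

Lemma Cmod_le_sum (z : C) : Cmod z <= Rabs (Re z) + Rabs (Im z).
Proof.
  pose proof (Rabs_pos (Re z)); pose proof (Rabs_pos (Im z)).
  apply Rsqr_incr_0_var; [rewrite !Rsqr_pow2, Cmod_sqr | lra].
  rewrite <- (pow2_abs (Re z)), <- (pow2_abs (Im z)); nra.
Qed.

Lemma Cmod_le_components (z w : C) :
  Rabs (Re z) <= Rabs (Re w) -> Rabs (Im z) <= Rabs (Im w) ->
  Cmod z <= Cmod w.
Proof.
  intros H1 H2; unfold Cmod; apply sqrt_le_1_alt.
  rewrite <- (pow2_abs (fst z)), <- (pow2_abs (snd z)),
    <- (pow2_abs (fst w)), <- (pow2_abs (snd w)).
  apply Rplus_le_compat; apply pow_incr; split;
    first [apply Rabs_pos | assumption].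
Qed.

(** * Two facts about scalar functions *)

(** [tau] is the supremum of the times up to which [phi] has stayed below
    [e]. *)
Lemma first_exit (phi : R -> R) (a b e : R) :
  (forall t, a <= t <= b -> continuous phi t) ->
  a <= b -> phi a < e -> e <= phi b ->
  exists tau, a < tau <= b /\ e <= phi tau /\
    forall s, a <= s < tau -> phi s < e.
Proof.
  intros Hc Hab Ha Hb.
  set (E := fun s => a <= s <= b /\ forall r, a <= r <= s -> phi r < e).
  assert (HE : E a).
  { split; [lra | ]; intros r Hr; now replace r with a by lra. }
  destruct (completeness E) as [tau [Hub Hlub]].
  { exists b; intros s [Hs _]; apply Hs. }
  { now exists a. }
  assert (Hta : a <= tau) by now apply Hub.
  assert (Htb : tau <= b) by (apply Hlub; intros s [Hs _]; apply Hs).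
  assert (Hbelow : forall s, a <= s < tau -> phi s < e).
  { intros s Hs; apply Rnot_le_lt; intros Hse.
    apply (Rlt_not_le tau s); [apply Hs | ].
    apply Hlub; intros x [Hx Hxe]; apply Rnot_lt_le; intros Hsx.
    apply (Rlt_not_le e (phi s)); [apply Hxe; lra | exact Hse]. }
  assert (He : e <= phi tau).
  { apply Rnot_lt_le; intros Hlt.
    destruct (Hc tau (conj Hta Htb) (fun y => y < e)) as [d Hd].
    { now apply open_lt. }
    destruct (Rle_lt_dec b (tau + d / 2)) as [Hbd | Hbd].
    - apply (Rlt_not_le e (phi b)); [ | exact Hb].
      apply (Hd b), Rabs_def1; unfold minus, plus, opp; simpl;
        pose proof (cond_pos d); lra.
    - assert (tau + d / 2 <= tau); [ | pose proof (cond_pos d); lra].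
      apply Hub; split; [pose proof (cond_pos d); lra | ].
      intros r Hr; destruct (Rlt_le_dec r tau) as [Hrt | Hrt].
      + apply Hbelow; lra.
      + apply (Hd r), Rabs_def1; unfold minus, plus, opp; simpl;
          pose proof (cond_pos d); lra. }
  exists tau; repeat split; auto.
  destruct Hta as [Hta | Hta]; [exact Hta | ].
  rewrite <- Hta in He; lra.
Qed.

(** The product of [phi] with exp (- k (t - a)) is nonincreasing. *)
Lemma gronwall (phi D : R -> R) (k a b : R) :
  a <= b ->
  (forall t, a <= t <= b -> is_derive phi t (D t)) ->
  (forall t, a <= t < b -> D t <= k * phi t) ->
  phi b <= phi a * exp (k * (b - a)).
Proof.
  intros [Hab | <-] HD Hle.
  2:{ rewrite Rminus_diag, Rmult_0_r, exp_0; lra. }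
  set (psi := fun t => phi t * exp (- k * (t - a))).
  assert (Hpsi : forall t, a <= t <= b ->
    is_derive psi t ((D t - k * phi t) * exp (- k * (t - a)))).
  { intros t Ht; unfold psi; auto_derive.
    - exists (D t); exact (HD t Ht).
    - replace (Derive (fun x => phi x) t) with (D t)
        by (symmetry; apply is_derive_unique, HD, Ht).
      unfold Rminus; ring. }
  assert (H : psi b <= psi a).
  { destruct (MVT_cor2 psi
      (fun t => (D t - k * phi t) * exp (- k * (t - a))) a b Hab)
      as [c [Hc Hcab]].
    { intros c Hc; apply is_derive_Reals, Hpsi, Hc. }
    assert ((D c - k * phi c) * exp (- k * (c - a)) <= 0).
    { specialize (Hle c); pose proof (exp_pos (- k * (c - a))); nra. }
    nra. }
  unfold psi in H; rewrite Rminus_diag, Rmult_0_r, exp_0, Rmult_1_r in H.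
  replace (phi b)
    with (phi b * exp (- k * (b - a)) * exp (k * (b - a))).
  - apply Rmult_le_compat_r; [left; apply exp_pos | exact H].
  - rewrite Rmult_assoc, <- exp_plus.
    replace (- k * (b - a) + k * (b - a)) with 0 by ring.
    rewrite exp_0; ring.
Qed.

(** * Quadratic Lyapunov functions of planar systems *)

(** The time argument lets the notions for time-dependent fields apply. *)
Definition planar (X Y : R -> R -> R) (t : R) (u : C) : C :=
  (X (Re u) (Im u), Y (Re u) (Im u)).

Definition mat2 (p q r s : R) : matrix 2 2 := [ [p, q], [r, s] ].

Definition quad (a b c x y : R) : R := a * x ^ 2 + 2 * b * x * y + c * y ^ 2.

Definition quad_deriv (a b c x y x' y' : R) : R :=
  (2 * a * x + 2 * b * y) * x' + (2 * b * x + 2 * c * y) * y'.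

Lemma is_derive_quad (a b c : R) (x y : R -> R) (t x' y' : R) :
  is_derive x t x' -> is_derive y t y' ->
  is_derive (fun s => quad a b c (x s) (y s)) t
    (quad_deriv a b c (x t) (y t) x' y').
Proof.
  intros Hx Hy; unfold quad, quad_deriv; auto_derive.
  - repeat split; eexists; eassumption.
  - replace (Derive (fun s => x s) t) with x'
      by (symmetry; now apply is_derive_unique).
    replace (Derive (fun s => y s) t) with y'
      by (symmetry; now apply is_derive_unique).
    ring.
Qed.

Lemma quad_le (a b c x y : R) :
  quad a b c x y <= (Rabs a + Rabs b + Rabs c) * (x ^ 2 + y ^ 2).
Proof.
  unfold quad.
  pose proof (Rle_abs a); pose proof (Rle_abs c).
  pose proof (Rle_abs b); pose proof (Rle_abs (- b)); rewrite Rabs_Ropp in *.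
  pose proof (pow2_ge_0 (x - y)); pose proof (pow2_ge_0 (x + y)).
  assert (a * x ^ 2 <= Rabs a * x ^ 2).
  { apply Rmult_le_compat_r; [apply pow2_ge_0 | lra]. }
  assert (c * y ^ 2 <= Rabs c * y ^ 2).
  { apply Rmult_le_compat_r; [apply pow2_ge_0 | lra]. }
  assert (0 <= Rabs a * y ^ 2).
  { apply Rmult_le_pos; [apply Rabs_pos | apply pow2_ge_0]. }
  assert (0 <= Rabs c * x ^ 2).
  { apply Rmult_le_pos; [apply Rabs_pos | apply pow2_ge_0]. }
  assert (2 * b * x * y <= Rabs b * (x ^ 2 + y ^ 2)).
  { destruct (Rle_dec 0 b).
    - rewrite Rabs_pos_eq by lra; nra.
    - rewrite Rabs_left by lra; nra. }
  nra.
Qed.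

(** The gradient of a quadratic form is linear, so the remainder of the field,
    which is small compared to |u|, contributes only a small multiple of
    |u|^2 to the derivative of the form along the flow. *)
Lemma quad_deriv_linearization (X Y : R -> R -> R) (p q r s a b c : R) :
  X 0 0 = 0 -> Y 0 0 = 0 -> is_jacobian X Y 0 0 (mat2 p q r s) ->
  forall eta : posreal, exists delta : posreal,
    forall x y, Rabs x < delta -> Rabs y < delta ->
    Rabs (quad_deriv a b c x y (X x y) (Y x y)
          - quad_deriv a b c x y (p * x + q * y) (r * x + s * y))
    <= eta * (x ^ 2 + y ^ 2).
Proof.
  intros HX0 HY0 [HX HY] eta.
  set (K := Rabs a + 2 * Rabs b + Rabs c + 1).
  assert (HK : 0 < K).
  { unfold K; pose proof (Rabs_pos a); pose proof (Rabs_pos b);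
      pose proof (Rabs_pos c); lra. }
  assert (He : 0 < eta / (4 * K)).
  { apply Rdiv_lt_0_compat; [apply eta | lra]. }
  destruct (HX (mkposreal _ He)) as [d1 H1].
  destruct (HY (mkposreal _ He)) as [d2 H2].
  exists (mkposreal _ (Rmin_stable_in_posreal d1 d2)); simpl.
  intros x y Hx Hy.
  specialize (H1 x y); specialize (H2 x y); simpl in H1, H2.
  rewrite HX0, !Rminus_0_r in H1; rewrite HY0, !Rminus_0_r in H2.
  specialize (H1 (Rlt_le_trans _ _ _ Hx (Rmin_l _ _))
                 (Rlt_le_trans _ _ _ Hy (Rmin_l _ _))).
  specialize (H2 (Rlt_le_trans _ _ _ Hx (Rmin_r _ _))
                 (Rlt_le_trans _ _ _ Hy (Rmin_r _ _))).
  set (m := Rmax (Rabs x) (Rabs y)) in *.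
  assert (Hxm : Rabs x <= m) by apply Rmax_l.
  assert (Hym : Rabs y <= m) by apply Rmax_r.
  assert (Hm0 : 0 <= m) by (pose proof (Rabs_pos x); lra).
  assert (Hm : m ^ 2 <= x ^ 2 + y ^ 2).
  { unfold m, Rmax; destruct (Rle_dec (Rabs x) (Rabs y));
      rewrite pow2_abs; pose proof (pow2_ge_0 x); pose proof (pow2_ge_0 y);
      lra. }
  replace (quad_deriv a b c x y (X x y) (Y x y)
           - quad_deriv a b c x y (p * x + q * y) (r * x + s * y))
    with ((2 * a * x + 2 * b * y) * (X x y - (p * x + q * y))
          + (2 * b * x + 2 * c * y) * (Y x y - (r * x + s * y)))
    by (unfold quad_deriv; ring).
  apply Rle_trans with (1 := Rabs_triang _ _); rewrite !Rabs_mult.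
  assert (Hlin : forall a b, Rabs (2 * a * x + 2 * b * y)
                   <= 2 * (Rabs a + Rabs b) * m).
  { intros a' b'; apply Rle_trans with (1 := Rabs_triang _ _).
    rewrite !Rabs_mult, (Rabs_pos_eq 2) by lra.
    pose proof (Rabs_pos a'); pose proof (Rabs_pos b'); nra. }
  apply Rle_trans with
    (2 * (Rabs a + Rabs b) * m * (eta / (4 * K) * m)
     + 2 * (Rabs b + Rabs c) * m * (eta / (4 * K) * m)).
  - apply Rplus_le_compat; apply Rmult_le_compat;
      try apply Rabs_pos; try apply Hlin; assumption.
  - replace (2 * (Rabs a + Rabs b) * m * (eta / (4 * K) * m)
             + 2 * (Rabs b + Rabs c) * m * (eta / (4 * K) * m))
      with (eta * ((K - 1) / (2 * K)) * m ^ 2)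
      by (unfold K; field; fold K; lra).
    apply Rle_trans with (eta * 1 * (x ^ 2 + y ^ 2)); [ | lra].
    assert ((K - 1) / (2 * K) <= 1).
    { apply Rmult_le_reg_r with (2 * K); [lra | ].
      unfold Rdiv; rewrite Rmult_assoc, Rinv_l by lra; lra. }
    assert (0 <= (K - 1) / (2 * K)).
    { apply Rdiv_le_0_compat; [ | lra]; unfold K.
      pose proof (Rabs_pos a); pose proof (Rabs_pos b);
      pose proof (Rabs_pos c); lra. }
    pose proof (cond_pos eta).
    apply Rmult_le_compat; [ | apply pow2_ge_0 | | exact Hm].
    + apply Rmult_le_pos; lra.
    + apply Rmult_le_compat_l; lra.
Qed.

(** The quadratic form det A |u|^2 + |adj A u|^2 of the matrix A with rows
    (p, q) and (r, s), see [lyap_eq]; it solves the Lyapunov equation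
    A^T P + P A = 2 tr A det A, since A + adj A = tr A. *)
Definition lyap (p q r s x y : R) : R :=
  quad (p * s - q * r + s ^ 2 + r ^ 2) (- (q * s + p * r))
    (p * s - q * r + q ^ 2 + p ^ 2) x y.

Lemma lyap_eq (p q r s x y : R) :
  lyap p q r s x y
  = (p * s - q * r) * (x ^ 2 + y ^ 2)
    + (s * x - q * y) ^ 2 + (p * y - r * x) ^ 2.
Proof. unfold lyap, quad; ring. Qed.

Definition lyap_deriv (p q r s x y x' y' : R) : R :=
  quad_deriv (p * s - q * r + s ^ 2 + r ^ 2) (- (q * s + p * r))
    (p * s - q * r + q ^ 2 + p ^ 2) x y x' y'.

(** Along u' = A u the form built from A - k has the derivative it would have
    along u' = (A - k) u plus 2 k times itself, because it is homogeneous of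
    degree 2. *)
Lemma lyap_deriv_shifted (p q r s k x y : R) :
  lyap_deriv (p - k) q r (s - k) x y (p * x + q * y) (r * x + s * y)
  = 2 * k * lyap (p - k) q r (s - k) x y
    + 2 * (p - k + (s - k)) * ((p - k) * (s - k) - q * r) * (x ^ 2 + y ^ 2).
Proof. unfold lyap_deriv, lyap, quad_deriv, quad; ring. Qed.

(** * Linearised asymptotic stability *)

Lemma lyap_along_solution (X Y : R -> R -> R) (p q r s : R) (u : R -> C)
    (t0 : R) (t1 : Rbar) :
  solution_on (planar X Y) u t0 t1 ->
  forall t, t0 <= t -> Rbar_lt t t1 ->
    is_derive (fun t => lyap p q r s (Re (u t)) (Im (u t))) t
      (lyap_deriv p q r s (Re (u t)) (Im (u t))
         (X (Re (u t)) (Im (u t))) (Y (Re (u t)) (Im (u t)))).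
Proof.
  intros Hu t Ht0 Ht1; specialize (Hu t Ht0 Ht1).
  apply is_derive_C_iff in Hu; destruct Hu as [H1 H2].
  exact (is_derive_quad _ _ _ _ _ _ _ _ H1 H2).
Qed.

Lemma continuous_solution_Cmod (g : R -> C -> C) (u : R -> C) (t0 : R)
    (t1 : Rbar) :
  solution_on g u t0 t1 ->
  forall t, t0 <= t -> Rbar_lt t t1 -> continuous (fun t => Cmod (u t)) t.
Proof.
  intros Hu t Ht0 Ht1.
  apply (continuous_ext (fun t => norm (V := C_R_NormedModule) (u t))).
  { intros; apply norm_C_R. }
  apply (continuous_comp (V := C_R_NormedModule) u
           (norm (V := C_R_NormedModule))).
  - apply (ex_derive_continuous (V := C_R_NormedModule)).
    exists (g t (u t)); now apply Hu.
  - apply @filterlim_norm.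
Qed.

(** The Lyapunov form is comparable to |u|^2 and satisfies V' <= - k V
    near 0 for some k > 0.  A solution that starts deep enough inside
    a sublevel set cannot reach the boundary of the ball, so the estimate
    holds for its whole life. *)
Lemma exponential_attraction (X Y : R -> R -> R) (p q r s : R) :
  X 0 0 = 0 -> Y 0 0 = 0 -> is_jacobian X Y 0 0 (mat2 p q r s) ->
  p + s < 0 -> 0 < p * s - q * r ->
  exists k K : posreal, forall e : posreal, exists d : posreal,
    forall (u : R -> C) (t0 : R) (t1 : Rbar),
      solution_on (planar X Y) u t0 t1 -> Cmod (u t0) < d ->
      forall t, t0 <= t -> Rbar_lt t t1 ->
        Cmod (u t) < e /\
        Cmod (u t) ^ 2 <= K * exp (- k * (t - t0)).
Proof.
  intros HX0 HY0 HJ Htr Hdet.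
  set (m := p * s - q * r) in *.
  set (c := - ((p + s) * m)).
  assert (Hc : 0 < c) by (unfold c; nra).
  set (V := fun z : C => lyap p q r s (Re z) (Im z)).
  set (K := Rabs (m + s ^ 2 + r ^ 2) + Rabs (- (q * s + p * r))
            + Rabs (m + q ^ 2 + p ^ 2)).
  assert (HVK : forall z, V z <= K * Cmod z ^ 2).
  { intros z; rewrite Cmod_sqr; apply quad_le. }
  assert (HVm : forall z, m * Cmod z ^ 2 <= V z).
  { intros z; rewrite Cmod_sqr; unfold V; rewrite lyap_eq; fold m.
    pose proof (pow2_ge_0 (s * Re z - q * Im z)).
    pose proof (pow2_ge_0 (p * Im z - r * Re z)); lra. }
  assert (HmK : m <= K).
  { unfold K; pose proof (Rle_abs (m + s ^ 2 + r ^ 2)).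
    pose proof (Rabs_pos (- (q * s + p * r))).
    pose proof (Rabs_pos (m + q ^ 2 + p ^ 2)).
    pose proof (pow2_ge_0 s); pose proof (pow2_ge_0 r); lra. }
  assert (HK : 0 < K) by lra.
  destruct (quad_deriv_linearization X Y p q r s (m + s ^ 2 + r ^ 2)
    (- (q * s + p * r)) (m + q ^ 2 + p ^ 2) HX0 HY0 HJ (mkposreal _ Hc))
    as [delta Hdelta]; cbn [pos] in Hdelta.
  assert (Hk : 0 < c / K) by now apply Rdiv_lt_0_compat.
  assert (Hdecay : forall z, Cmod z < delta ->
    lyap_deriv p q r s (Re z) (Im z) (X (Re z) (Im z)) (Y (Re z) (Im z))
    <= - (c / K) * V z).
  { intros z Hz.
    assert (HRe : Rabs (Re z) < delta).
    { apply Rle_lt_trans with (2 := Hz), Re_le_Cmod. }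
    assert (HIm : Rabs (Im z) < delta).
    { apply Rle_lt_trans with (2 := Hz), Im_le_Cmod. }
    specialize (Hdelta _ _ HRe HIm); apply Rabs_le_between in Hdelta.
    pose proof (lyap_deriv_shifted p q r s 0 (Re z) (Im z)) as Hlin.
    rewrite !Rminus_0_r in Hlin; fold m in Hlin.
    unfold lyap_deriv in *; fold m in Hlin; fold m.
    rewrite <- Cmod_sqr in *.
    specialize (HVK z).
    assert (c / K * V z <= c * Cmod z ^ 2).
    { apply Rmult_le_reg_l with K; [lra | ].
      replace (K * (c / K * V z)) with (c * V z) by (field; lra); nra. }
    fold c in Hlin; unfold c in *; lra. }
  assert (HB : 0 < K * delta ^ 2 / m).
  { apply Rdiv_lt_0_compat; [ | exact Hdet].
    apply Rmult_lt_0_compat, pow_lt, cond_pos; exact HK. }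
  exists (mkposreal _ Hk), (mkposreal _ HB); cbn [pos]; intros e.
  (* the decay estimate holds only in the ball of radius delta *)
  set (e' := Rmin e delta).
  assert (He' : 0 < e').
  { apply Rmin_glb_lt; apply cond_pos. }
  assert (Hd : 0 < e' * (m / (2 * K))).
  { apply Rmult_lt_0_compat; [exact He' | apply Rdiv_lt_0_compat; lra]. }
  exists (mkposreal _ Hd); cbn [pos]; intros u t0 t1 Hu Hu0.
  (* with |u(t0)| < e' w one has V(u(t0)) <= K (e' w)^2 < m e'^2, a
     lower bound of V on the circle of radius e' *)
  set (w := m / (2 * K)) in *.
  assert (Hw : 0 < w <= 1 / 2 /\ K * w = m / 2).
  { unfold w; split; [split | field; lra].
    - apply Rdiv_lt_0_compat; lra.
    - apply Rmult_le_reg_r with (2 * K); [lra | ].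
      replace (m / (2 * K) * (2 * K)) with m by (field; lra); lra. }
  assert (Hd' : e' * w < e') by nra.
  assert (Hflow : forall t, t0 <= t -> Rbar_lt t t1 ->
    (forall x, t0 <= x < t -> Cmod (u x) < e') ->
    V (u t) <= V (u t0) * exp (- (c / K) * (t - t0))).
  { intros t Ht0 Ht1 Hin.
    apply (gronwall (fun t => V (u t)) (fun t =>
      lyap_deriv p q r s (Re (u t)) (Im (u t))
         (X (Re (u t)) (Im (u t))) (Y (Re (u t)) (Im (u t))))).
    - exact Ht0.
    - intros x Hx.
      apply (lyap_along_solution X Y p q r s u t0 t1 Hu); [apply Hx | ].
      apply Rbar_le_lt_trans with (2 := Ht1), Hx.
    - intros x Hx; apply Hdecay.
      apply Rlt_le_trans with (1 := Hin x Hx), Rmin_r. }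
  assert (Hu0n : 0 <= Cmod (u t0)) by apply Cmod_ge_0.
  assert (HV0 : V (u t0) <= K * (e' * w) ^ 2).
  { apply Rle_trans with (1 := HVK _), Rmult_le_compat_l; [lra | ].
    apply pow_incr; lra. }
  assert (Htrap : forall t, t0 <= t -> Rbar_lt t t1 -> Cmod (u t) < e').
  { intros t Ht0 Ht1; apply Rnot_le_lt; intros Hexit.
    destruct (first_exit (fun t => Cmod (u t)) t0 t e')
      as [tau [Htau [Hout Hin]]].
    - intros x Hx; apply continuous_solution_Cmod with (1 := Hu); [apply Hx | ].
      apply Rbar_le_lt_trans with (2 := Ht1), Hx.
    - exact Ht0.
    - lra.
    - exact Hexit.
    - assert (H := Hflow tau (Rlt_le _ _ (proj1 Htau))
        (Rbar_le_lt_trans tau t t1 (proj2 Htau) Ht1) Hin).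
      assert (Hexp : exp (- (c / K) * (tau - t0)) <= 1).
      { rewrite <- exp_0; left; apply exp_increasing; nra. }
      assert (m * e' ^ 2 <= V (u tau)).
      { apply Rle_trans with (2 := HVm _), Rmult_le_compat_l; [lra | ].
        apply pow_incr; lra. }
      assert (0 <= V (u t0)).
      { apply Rle_trans with (2 := HVm _), Rmult_le_pos;
          [lra | apply pow2_ge_0]. }
      assert (K * (e' * w) ^ 2 < m * e' ^ 2).
      { replace (K * (e' * w) ^ 2) with (K * w * w * e' ^ 2) by ring.
        apply Rmult_lt_compat_r; [nra | ].
        destruct Hw as [Hw ->]; nra. }
      pose proof (exp_pos (- (c / K) * (tau - t0))); nra. }
  intros t Ht0 Ht1; split.
  { apply Rlt_le_trans with (1 := Htrap t Ht0 Ht1), Rmin_l. }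
  assert (H := Hflow t Ht0 Ht1 (fun x Hx => Htrap x (proj1 Hx)
    (Rbar_lt_trans x t t1 (proj2 Hx) Ht1))).
  specialize (HVm (u t)).
  assert (HV : V (u t0) <= K * delta ^ 2).
  { apply Rle_trans with (1 := HVK _), Rmult_le_compat_l; [lra | ].
    apply pow_incr; split; [exact Hu0n | ].
    pose proof (Rmin_r e delta : e' <= delta); lra. }
  apply Rmult_le_reg_l with m; [exact Hdet | ].
  apply Rle_trans with (1 := HVm), Rle_trans with (1 := H).
  replace (m * (K * delta ^ 2 / m * exp (- (c / K) * (t - t0))))
    with (K * delta ^ 2 * exp (- (c / K) * (t - t0))) by (field; lra).
  apply Rmult_le_compat_r; [left; apply exp_pos | exact HV].
Qed.

Lemma is_lim_exp_decay (k K t0 : R) :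
  0 < k -> is_lim (fun t => K * exp (- k * (t - t0))) p_infty 0.
Proof.
  intros Hk.
  apply is_lim_ext with (fun t => K * exp (k * t0) * exp (- k * t + 0)).
  { intros t; rewrite Rmult_assoc, <- exp_plus; do 2 f_equal; ring. }
  replace (Finite 0) with (Rbar_mult (K * exp (k * t0)) 0)
    by (simpl; f_equal; ring).
  apply is_lim_scal_l.
  apply is_lim_comp_lin; [ | lra].
  replace (Rbar_plus (Rbar_mult (- k) p_infty) 0) with m_infty.
  { apply is_lim_exp_m. }
  simpl; destruct (Rle_dec 0 (- k)); [exfalso; lra | reflexivity].
Qed.

Theorem planar_asymptotically_stable (X Y : R -> R -> R) (p q r s : R) :
  X 0 0 = 0 -> Y 0 0 = 0 -> is_jacobian X Y 0 0 (mat2 p q r s) ->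
  p + s < 0 -> 0 < p * s - q * r ->
  asymptotically_stable (planar X Y) (fun _ => 0%C).
Proof.
  intros HX0 HY0 HJ Htr Hdet.
  destruct (exponential_attraction X Y p q r s HX0 HY0 HJ Htr Hdet)
    as [k [K H]].
  split.
  - intros t0 e; destruct (H e) as [d Hd]; exists d.
    intros u t1 Hu Hu0 t Ht; rewrite Cminus_0_r in *.
    apply (Hd u t0 t1 Hu Hu0 t); apply Ht.
  - intros t0; destruct (H (mkposreal 1 Rlt_0_1)) as [d Hd]; exists d.
    intros u Hu Hu0; rewrite Cminus_0_r in Hu0.
    specialize (Hd u t0 p_infty Hu Hu0).
    apply is_lim_ext with (fun t => Cmod (u t)).
    { intros t; now rewrite Cminus_0_r. }
    apply is_lim_spec; intros e.
    assert (He : 0 < e ^ 2) by (pose proof (cond_pos e); nra).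
    pose proof (is_lim_exp_decay k K t0 (cond_pos k)) as Hlim.
    apply is_lim_spec in Hlim; destruct (Hlim (mkposreal _ He)) as [T HT].
    simpl in HT.
    exists (Rmax t0 T); intros t Ht.
    specialize (HT t (Rle_lt_trans _ _ _ (Rmax_r _ _) Ht)).
    destruct (Hd t) as [_ Hle].
    { left; exact (Rle_lt_trans _ _ _ (Rmax_l _ _) Ht). }
    { exact I. }
    rewrite Rminus_0_r in *.
    rewrite Rabs_pos_eq by apply Cmod_ge_0.
    apply Rabs_def2 in HT.
    apply Rnot_le_lt; intros Hge.
    pose proof (pow_incr e (Cmod (u t)) 2
      (conj (Rlt_le _ _ (cond_pos e)) Hge)); lra.
Qed.

(** * Linearised instability *)

Definition clamp (x : R) : R := Rmax (-1) (Rmin 1 x).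

(** The nearest-point projection onto the box: composing with it makes a field
    that is Lipschitz on the box globally Lipschitz and bounded, without
    changing it on the box. *)
Definition Cclamp (z : C) : C := (clamp (Re z), clamp (Im z)).

Lemma clamp_bound (x : R) : Rabs (clamp x) <= 1.
Proof.
  unfold clamp, Rmax, Rmin; apply Rabs_le.
  destruct (Rle_dec 1 x); destruct Rle_dec; lra.
Qed.

Lemma clamp_id (x : R) : Rabs x <= 1 -> clamp x = x.
Proof.
  intros H; apply Rabs_le_between in H.
  unfold clamp; rewrite Rmin_right, Rmax_right; lra.
Qed.

Lemma clamp_lipschitz (x y : R) : Rabs (clamp x - clamp y) <= Rabs (x - y).
Proof.
  unfold clamp, Rmax, Rmin.
  destruct (Rle_dec 1 x), (Rle_dec 1 y); repeat destruct Rle_dec;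
    unfold Rabs; repeat destruct Rcase_abs; lra.
Qed.

Lemma Cclamp_lipschitz (z w : C) :
  Cmod (Cclamp z - Cclamp w) <= Cmod (z - w).
Proof. apply Cmod_le_components; apply clamp_lipschitz. Qed.

Definition unit_box (z : C) : Prop := Rabs (Re z) <= 1 /\ Rabs (Im z) <= 1.

Definition lipschitz_on (D : C -> Prop) (h : C -> C) : Prop :=
  exists K : R, forall z w, D z -> D w ->
    Cmod (h z - h w)%C <= K * Cmod (z - w)%C.

Lemma lipschitz_on_box_global_solution (h : C -> C) (t0 : R) (u0 : C) :
  lipschitz_on unit_box h ->
  exists u : R -> C,
    u t0 = u0 /\ solution_on (fun _ z => h (Cclamp z)) u t0 p_infty.
Proof.
  intros [K HK].
  assert (Hbox : forall z, unit_box (Cclamp z)).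
  { intros z; split; apply clamp_bound. }
  assert (Hlip : forall z w,
    Cmod (h (Cclamp z) - h (Cclamp w))%C <= Rabs K * Cmod (z - w)%C).
  { intros z w; apply Rle_trans with (1 := HK _ _ (Hbox z) (Hbox w)).
    apply Rle_trans with (Rabs K * Cmod (Cclamp z - Cclamp w)%C).
    - apply Rmult_le_compat_r; [apply Cmod_ge_0 | apply Rle_abs].
    - apply Rmult_le_compat_l; [apply Rabs_pos | apply Cclamp_lipschitz]. }
  destruct (picard_lindelof C_R_CompleteNormedModule (fun z => h (Cclamp z))
    (Rabs K) (Rabs K * 2 + Cmod (h (Cclamp 0))) ) with t0 u0 as [u [Hu0 Hu]].
  - intros z w.
    change (norm (V := C_R_NormedModule) (h (Cclamp z) - h (Cclamp w))%C
            <= Rabs K * norm (V := C_R_NormedModule) (z - w)%C).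
    rewrite !norm_C_R; apply Hlip.
  - intros z; apply Rle_trans with (Cmod (h (Cclamp z))).
    { right; apply norm_C_R. }
    replace (h (Cclamp z))
      with ((h (Cclamp z) - h (Cclamp 0)) + h (Cclamp 0))%C by ring.
    apply Rle_trans with (1 := Cmod_triangle _ _), Rplus_le_compat_r.
    apply Rle_trans with (1 := HK _ _ (Hbox z) (Hbox 0%C)).
    apply Rle_trans with (Rabs K * Cmod (Cclamp z - Cclamp 0)%C).
    { apply Rmult_le_compat_r; [apply Cmod_ge_0 | apply Rle_abs]. }
    apply Rmult_le_compat_l; [apply Rabs_pos | ].
    apply Rle_trans with (Cmod (1, 1)).
    + apply Cmod_le_components; simpl; rewrite (clamp_id 0) by
        (rewrite Rabs_R0; lra); rewrite Ropp_0, Rplus_0_r, (Rabs_pos_eq 1)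
        by lra; apply clamp_bound.
    + unfold Cmod; simpl; replace 2 with (sqrt 4).
      * apply sqrt_le_1_alt; lra.
      * replace 4 with (2 * 2) by ring; apply sqrt_square; lra.
  - exists u; split; [exact Hu0 | ].
    intros t Ht _; exact (Hu t Ht).
Qed.

(** The two values add up to (p + s)^2 + (q - r)^2, the trace of the form. *)
Lemma lyap_positive_direction (p q r s : R) :
  p + s <> 0 -> 0 < lyap p q r s 1 0 \/ 0 < lyap p q r s 0 1.
Proof.
  intros Htr.
  assert (H : lyap p q r s 1 0 + lyap p q r s 0 1 = (p + s) ^ 2 + (q - r) ^ 2).
  { rewrite !lyap_eq; ring. }
  assert (0 < (p + s) ^ 2) by (apply pow2_gt_0, Htr).
  pose proof (pow2_ge_0 (q - r)); lra.
Qed.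

(** The hypothesis on [k] says that trace and determinant of A - k have the
    same strict sign, whence V' >= k' V near 0 for some k' > 0.  If 0 were
    stable, the global solution of the clamped field would never leave a small
    ball, so it would solve the original system while V grows without bound. *)
Theorem planar_unstable (X Y : R -> R -> R) (p q r s k : R) :
  X 0 0 = 0 -> Y 0 0 = 0 -> is_jacobian X Y 0 0 (mat2 p q r s) ->
  lipschitz_on unit_box (planar X Y 0) ->
  0 <= k -> 0 < (p - k + (s - k)) * ((p - k) * (s - k) - q * r) ->
  ~ lyapunov_stable (planar X Y) (fun _ => 0%C).
Proof.
  intros HX0 HY0 HJ HLip Hk Hc Hstable.
  set (c := (p - k + (s - k)) * ((p - k) * (s - k) - q * r)) in *.
  set (V := fun z : C => lyap (p - k) q r (s - k) (Re z) (Im z)).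
  assert (HV : exists K : posreal, forall z, V z <= K * Cmod z ^ 2).
  { unfold V, lyap.
    match goal with |- context [quad ?x ?y ?z _ _] =>
      set (a := x); set (b := y); set (d := z) end.
    assert (HK : 0 < Rabs a + Rabs b + Rabs d + 1).
    { pose proof (Rabs_pos a); pose proof (Rabs_pos b);
        pose proof (Rabs_pos d); lra. }
    exists (mkposreal _ HK); cbn [pos]; intros z; rewrite Cmod_sqr.
    apply Rle_trans with (1 := quad_le _ _ _ _ _), Rmult_le_compat_r; [ | lra].
    apply Rplus_le_le_0_compat; apply pow2_ge_0. }
  destruct HV as [K HVK].
  assert (HK := cond_pos K).
  destruct (quad_deriv_linearization X Y p q r s
    ((p - k) * (s - k) - q * r + (s - k) ^ 2 + r ^ 2)
    (- (q * (s - k) + (p - k) * r))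
    ((p - k) * (s - k) - q * r + q ^ 2 + (p - k) ^ 2)
    HX0 HY0 HJ (mkposreal _ Hc)) as [delta Hdelta]; cbn [pos] in Hdelta.
  set (k' := 2 * k + c / K).
  assert (Hk' : 0 < k').
  { unfold k'; assert (0 < c / K) by now apply Rdiv_lt_0_compat. lra. }
  assert (Hgrow : forall z, Cmod z < delta ->
    k' * V z <= lyap_deriv (p - k) q r (s - k) (Re z) (Im z)
                  (X (Re z) (Im z)) (Y (Re z) (Im z))).
  { intros z Hz.
    assert (HRe : Rabs (Re z) < delta).
    { apply Rle_lt_trans with (2 := Hz), Re_le_Cmod. }
    assert (HIm : Rabs (Im z) < delta).
    { apply Rle_lt_trans with (2 := Hz), Im_le_Cmod. }
    specialize (Hdelta _ _ HRe HIm); apply Rabs_le_between in Hdelta.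
    pose proof (lyap_deriv_shifted p q r s k (Re z) (Im z)) as Hlin.
    fold (V z) in Hlin.
    replace (2 * (p - k + (s - k)) * ((p - k) * (s - k) - q * r))
      with (2 * c) in Hlin by (unfold c; ring).
    unfold lyap_deriv in *.
    rewrite <- Cmod_sqr in *.
    specialize (HVK z).
    assert (c / K * V z <= c * Cmod z ^ 2).
    { apply Rmult_le_reg_l with K; [lra | ].
      replace (K * (c / K * V z)) with (c * V z) by (field; lra); nra. }
    unfold k'; lra. }
  set (e := Rmin delta 1).
  assert (He : 0 < e) by (apply Rmin_glb_lt; [apply cond_pos | lra]).
  (* stability is used with e / 2: at the first exit from the ball of
     radius e, continuity contradicts the bound e / 2 at earlier times *)
  assert (He2 : 0 < e / 2) by lra.
  destruct (Hstable 0 (mkposreal _ He2)) as [d Hd]; cbn [pos] in Hd.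
  set (d' := Rmin d e / 2).
  assert (Hd' : 0 < d' /\ d' < d /\ d' < e).
  { pose proof (Rmin_l d e); pose proof (Rmin_r d e).
    assert (0 < Rmin d e) by (apply Rmin_glb_lt; [apply cond_pos | lra]).
    unfold d'; lra. }
  assert (Hu0 : exists u0 : C, Cmod u0 = d' /\ 0 < V u0).
  { assert (Hscal : forall x y, V (d' * x, d' * y) = d' ^ 2 *
      lyap (p - k) q r (s - k) x y).
    { intros x y; unfold V; simpl Re; simpl Im; rewrite !lyap_eq; ring. }
    assert (Hd2 : 0 < d' ^ 2) by (apply pow_lt; lra).
    destruct (lyap_positive_direction (p - k) q r (s - k)) as [H | H].
    - intros H; apply (Rlt_irrefl 0); unfold c in Hc; rewrite H in Hc; lra.
    - exists (d' * 1, d' * 0); rewrite Hscal; split; [ | nra].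
      unfold Cmod; simpl fst; simpl snd.
      replace ((d' * 1) ^ 2 + (d' * 0) ^ 2) with (d' * d') by ring.
      apply sqrt_square; lra.
    - exists (d' * 0, d' * 1); rewrite Hscal; split; [ | nra].
      unfold Cmod; simpl fst; simpl snd.
      replace ((d' * 0) ^ 2 + (d' * 1) ^ 2) with (d' * d') by ring.
      apply sqrt_square; lra. }
  destruct Hu0 as [u0 [Hu0 HV0]].
  destruct (lipschitz_on_box_global_solution _ 0 u0 HLip) as [u [Hut0 Hu]].
  assert (Hsol : forall t1 : Rbar,
    (forall t, 0 <= t -> Rbar_lt t t1 -> Cmod (u t) < e) ->
    solution_on (planar X Y) u 0 t1).
  { intros t1 Hin t Ht0 Ht1.
    specialize (Hin t Ht0 Ht1).
    replace (planar X Y t (u t)) with (planar X Y 0 (Cclamp (u t))).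
    { apply Hu; [exact Ht0 | exact I]. }
    pose proof (Rmin_r delta 1 : e <= 1).
    pose proof (Re_le_Cmod (u t)); pose proof (Im_le_Cmod (u t)).
    unfold planar, Cclamp; simpl Re; simpl Im.
    rewrite !clamp_id by lra; reflexivity. }
  assert (Hcont : forall t, 0 <= t -> continuous (fun t => Cmod (u t)) t).
  { intros t Ht; apply (continuous_solution_Cmod _ u 0 p_infty Hu t Ht I). }
  assert (Hstay : forall t, 0 <= t -> Cmod (u t) < e).
  { intros t Ht; apply Rnot_le_lt; intros Hexit.
    destruct (first_exit (fun t => Cmod (u t)) 0 t e)
      as [tau [Htau [Hout Hin]]].
    - intros x Hx; apply Hcont, Hx.
    - exact Ht.
    - rewrite Hut0, Hu0; lra.
    - exact Hexit.
    - assert (Hhalf : forall s, 0 <= s < tau -> Cmod (u s) < e / 2).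
      { intros x Hx; rewrite <- (Cminus_0_r (u x)).
        apply (Hd u tau); [ | | exact Hx].
        - apply Hsol; intros; apply Hin; split; assumption.
        - rewrite Cminus_0_r, Hut0, Hu0; lra. }
      destruct (Hcont tau (Rlt_le _ _ (proj1 Htau)) (fun y => e / 2 < y))
        as [h Hh].
      { apply open_gt; lra. }
      set (x := Rmax 0 (tau - h / 2)).
      assert (Hx : 0 <= x < tau).
      { split; [apply Rmax_l | apply Rmax_lub_lt; [lra | ]].
        pose proof (cond_pos h); lra. }
      apply (Rlt_asym _ _ (Hhalf x Hx)), Hh.
      pose proof (Rmax_r 0 (tau - h / 2) : _ <= x).
      apply Rabs_def1; unfold minus, plus, opp; simpl;
        pose proof (cond_pos h); lra. }
  assert (HVgrow : forall t, 0 <= t -> V u0 * (1 + k' * t) <= K * e ^ 2).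
  { intros t Ht.
    assert (H : - V (u t) <= - V (u 0) * exp (k' * (t - 0))).
    { apply (gronwall (fun t => - V (u t)) (fun t => -
        lyap_deriv (p - k) q r (s - k) (Re (u t)) (Im (u t))
          (X (Re (u t)) (Im (u t))) (Y (Re (u t)) (Im (u t))))).
      - exact Ht.
      - intros x Hx; apply @is_derive_opp.
        apply (lyap_along_solution X Y (p - k) q r (s - k) u 0 p_infty);
          [ | apply Hx | exact I].
        apply Hsol; intros; now apply Hstay.
      - intros x Hx.
        assert (Hxd : Cmod (u x) < delta).
        { apply Rlt_le_trans with (1 := Hstay x (proj1 Hx)), Rmin_l. }
        specialize (Hgrow _ Hxd); lra. }
    rewrite Hut0, Rminus_0_r in H.
    apply Rle_trans with (V u0 * exp (k' * t)).
    - apply Rmult_le_compat_l; [lra | apply exp_ineq1_le].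
    - apply Rle_trans with (V (u t)); [lra | ].
      apply Rle_trans with (1 := HVK _), Rmult_le_compat_l; [lra | ].
      apply pow_incr; split; [apply Cmod_ge_0 | left; now apply Hstay]. }
  (* at this time the linear lower bound of V exceeds K e^2 by V u0 *)
  specialize (HVgrow (K * e ^ 2 / (V u0 * k'))).
  assert (0 <= K * e ^ 2) by (apply Rmult_le_pos; [lra | apply pow2_ge_0]).
  assert (HVk : 0 < V u0 * k') by now apply Rmult_lt_0_compat.
  apply (Rlt_not_le (V u0 * (1 + k' * (K * e ^ 2 / (V u0 * k'))))
           (K * e ^ 2)).
  - replace (V u0 * (1 + k' * (K * e ^ 2 / (V u0 * k'))))
      with (V u0 + K * e ^ 2) by (field; lra); lra.
  - apply HVgrow, Rdiv_le_0_compat; assumption.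
Qed.

(** * Eigenvalues of real 2x2 matrices *)

Definition col2 (x y : C) : matrix 2 1 := [ [x], [y] ].

(** An eigenvector for a root is read off from the first row of A - mu when
    [q] is nonzero, from the second row when [mu] differs from [s], and is the
    second basis vector otherwise. *)
Lemma is_eigenvalue_char_poly (p q r s : R) (mu : C) :
  is_eigenvalue (mat2 p q r s) mu <->
  ((mu - p) * (mu - s) - q * r = 0)%C.
Proof.
  assert (Hsys : forall x y : C,
    Mmult (T := C_Ring)
      (mk_matrix 2 2 (fun i j => RtoC (coeff_mat 0 (mat2 p q r s) i j)))
      (col2 x y)
    = mk_matrix 2 1 (fun i j =>
        (mu * coeff_mat (RtoC 0) (col2 x y) i j)%C)
    <-> (p * x + q * y = mu * x /\ r * x + s * y = mu * y)%C).
  { intros x y; unfold Mmult; simpl pred.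
    unfold mk_matrix, mk_Tn, mat2, col2, coeff_mat, coeff_Tn.
    simpl fst; simpl snd.
    rewrite !sum_Sn, !sum_O; simpl fst; simpl snd.
    change (@plus C_Ring) with Cplus; change (@mult C_Ring) with Cmult.
    split.
    - intros H; split.
      + exact (f_equal (fun A : matrix 2 1 => fst (fst A)) H).
      + exact (f_equal (fun A : matrix 2 1 => fst (fst (snd A))) H).
    - intros [H1 H2]; rewrite <- H1, <- H2; reflexivity. }
  unfold is_eigenvalue; split.
  - intros [[[x []] [[y []] []]] [Hv H]].
    apply Hsys in H; destruct H as [H1 H2].
    set (chi := ((mu - p) * (mu - s) - q * r)%C).
    assert (Hx : (chi * x = 0)%C).
    { transitivity ((mu - s) * (mu * x - (p * x + q * y))
                    + q * (mu * y - (r * x + s * y)))%C.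
      - unfold chi; ring.
      - rewrite H1, H2; ring. }
    assert (Hy : (chi * y = 0)%C).
    { transitivity ((mu - p) * (mu * y - (r * x + s * y))
                    + r * (mu * x - (p * x + q * y)))%C.
      - unfold chi; ring.
      - rewrite H1, H2; ring. }
    destruct (Ceq_dec chi 0) as [Hchi | Hchi]; [exact Hchi | exfalso].
    apply Hv.
    assert (x = 0%C) as ->.
    { destruct (Ceq_dec x 0); [assumption | ].
      now destruct (Cmult_neq_0 chi x). }
    assert (y = 0%C) as ->.
    { destruct (Ceq_dec y 0); [assumption | ].
      now destruct (Cmult_neq_0 chi y). }
    reflexivity.
  - intros Hchi.
    assert (Hv : exists x y : C, ~ (x = 0%C /\ y = 0%C) /\
      (p * x + q * y = mu * x /\ r * x + s * y = mu * y)%C).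
    { destruct (Ceq_dec q 0) as [Hq | Hq].
      - destruct (Ceq_dec (mu - s)%C 0) as [Hs | Hs].
        + exists 0%C, 1%C; split.
          * intros [_ H]; injection H; lra.
          * rewrite Hq; replace mu with (RtoC s); [split; ring | ].
            replace mu with ((mu - s) + s)%C by ring; rewrite Hs; ring.
        + assert (Hp : (mu - p = 0)%C).
          { destruct (Ceq_dec (mu - p)%C 0); [assumption | ].
            destruct (Cmult_neq_0 (mu - p) (mu - s)); try assumption.
            rewrite <- Hchi, Hq; ring. }
          exists (mu - s)%C, (RtoC r); split; [now intros [H _] | ].
          split; [ | ring].
          rewrite Hq; replace mu with (RtoC p); [ring | ].
          replace mu with ((mu - p) + p)%C by ring; rewrite Hp; ring.
      - exists (RtoC q), (mu - p)%C; split; [now intros [H _] | ].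
        split; [ring | ].
        replace (mu * (mu - p))%C
          with (((mu - p) * (mu - s) - q * r) + (r * q + s * (mu - p)))%C
          by ring.
        rewrite Hchi; ring. }
    destruct Hv as [x [y [Hv H]]].
    exists (col2 x y); split; [ | now apply Hsys].
    intros Heq; apply Hv; split.
    + exact (f_equal (fun A : matrix 2 1 => fst (fst A)) Heq).
    + exact (f_equal (fun A : matrix 2 1 => fst (fst (snd A))) Heq).
Qed.

Lemma eigenvalue_components (p q r s x y : R) :
  is_eigenvalue (mat2 p q r s) (x, y) <->
  (x - p) * (x - s) - y * y - q * r = 0 /\ y * (2 * x - (p + s)) = 0.
Proof.
  rewrite is_eigenvalue_char_poly; split.
  - intros H; injection H; simpl; intros H1 H2; split; lra.
  - intros [H1 H2]; apply injective_projections; simpl; lra.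
Qed.

(** The eigenvalues are exhibited by the quadratic formula, with real or
    complex square root of the discriminant. *)
Lemma hurwitz_trace_det (p q r s : R) :
  (forall mu, is_eigenvalue (mat2 p q r s) mu -> Re mu < 0) ->
  p + s < 0 /\ 0 < p * s - q * r.
Proof.
  intros H.
  set (disc := (p + s) ^ 2 - 4 * (p * s - q * r)).
  destruct (Rle_dec 0 disc) as [Hd | Hd].
  - pose proof (sqrt_sqrt disc Hd) as Hs; pose proof (sqrt_pos disc).
    assert (Hneg : (p + s + sqrt disc) / 2 < 0).
    { apply (H ((p + s + sqrt disc) / 2, 0)), eigenvalue_components.
      split; [ | ring].
      replace ((_ - p) * (_ - s) - 0 * 0 - q * r)
        with ((sqrt disc * sqrt disc - disc) / 4) by (unfold disc; field).
      rewrite Hs; field. }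
    split; [lra | ].
    unfold disc in *; nra.
  - assert (Hd' : 0 <= - disc) by lra.
    pose proof (sqrt_sqrt (- disc) Hd') as Hs.
    assert (Hneg : (p + s) / 2 < 0).
    { apply (H ((p + s) / 2, sqrt (- disc) / 2)), eigenvalue_components.
      split; [ | field].
      replace (_ - q * r)
        with (- (sqrt (- disc) * sqrt (- disc) - - disc) / 4)
        by (unfold disc; field).
      rewrite Hs; field. }
    split; [lra | ].
    unfold disc in *; nra.
Qed.

(** The second factor is the characteristic polynomial at [k], that is the
    determinant of A - k, and the first one its trace.  [k = 0] works when both
    eigenvalues have positive real part.  Otherwise they are real, x > 0 >= w,
    and any [k] strictly between (x + w) / 2 and x that is positive makes both
    factors negative. *)
Lemma unstable_eigenvalue_shift (p q r s : R) (mu : C) :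
  is_eigenvalue (mat2 p q r s) mu -> 0 < Re mu ->
  exists k : R, 0 <= k /\
    0 < (p + s - 2 * k) * (p * s - q * r - k * (p + s) + k ^ 2).
Proof.
  destruct mu as [x y]; simpl Re; intros H Hx.
  apply eigenvalue_components in H; destruct H as [H1 H2].
  destruct (Req_dec y 0) as [-> | Hy].
  - set (w := p + s - x).
    assert (Hdet : p * s - q * r = x * w) by (unfold w; lra).
    assert (Htr : p + s = x + w) by (unfold w; ring).
    rewrite Hdet, Htr.
    destruct (Rlt_le_dec 0 w) as [Hw | Hw].
    + exists 0; split; [lra | ].
      apply Rmult_lt_0_compat; nra.
    (* 3 x / 4 lies in the required interval since w <= 0 *)
    + exists (3 * x / 4); split; [lra | ].
      replace (_ * _)
        with ((x / 2 - w) * (x / 4 * (3 * x / 4 - w))) by field.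
      apply Rmult_lt_0_compat; [lra | apply Rmult_lt_0_compat; lra].
  - apply Rmult_integral in H2; destruct H2 as [H2 | H2]; [contradiction | ].
    exists 0; split; [lra | ].
    assert (0 < y * y) by now apply Rsqr_pos_lt.
    apply Rmult_lt_0_compat; nra.
Qed.

(** * Differentials and Lipschitz bounds of polynomial expressions *)

Lemma differentiable_pt_lim_plus (f g : R -> R -> R) (x y fx fy gx gy : R) :
  differentiable_pt_lim f x y fx fy -> differentiable_pt_lim g x y gx gy ->
  differentiable_pt_lim (fun u v => f u v + g u v) x y (fx + gx) (fy + gy).
Proof.
  intros Hf Hg.
  replace (fx + gx) with (1 * fx + 1 * gx) by ring.
  replace (fy + gy) with (1 * fy + 1 * gy) by ring.
  apply (differentiable_pt_lim_comp Rplus); [ | exact Hf | exact Hg].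
  intros e; exists e; intros u v _ _.
  replace (u + v - (f x y + g x y) - _) with 0 by ring; rewrite Rabs_R0.
  apply Rmult_le_pos; [left; apply cond_pos | ].
  apply Rle_trans with (2 := Rmax_l _ _), Rabs_pos.
Qed.

Lemma differentiable_pt_lim_mult (f g : R -> R -> R) (x y fx fy gx gy : R) :
  differentiable_pt_lim f x y fx fy -> differentiable_pt_lim g x y gx gy ->
  differentiable_pt_lim (fun u v => f u v * g u v) x y
    (g x y * fx + f x y * gx) (g x y * fy + f x y * gy).
Proof.
  intros Hf Hg.
  apply (differentiable_pt_lim_comp Rmult); [ | exact Hf | exact Hg].
  intros e; exists e; intros u v Hu _.
  replace (u * v - f x y * g x y - _) with ((u - f x y) * (v - g x y)) by ring.
  rewrite Rabs_mult; apply Rmult_le_compat; try apply Rabs_pos; [lra | ].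
  apply Rmax_r.
Qed.

Lemma differentiable_pt_lim_comp_1 (h : R -> R) (f : R -> R -> R)
    (x y l fx fy : R) :
  is_derive h (f x y) l -> differentiable_pt_lim f x y fx fy ->
  differentiable_pt_lim (fun u v => h (f u v)) x y (l * fx) (l * fy).
Proof.
  intros Hh Hf.
  replace (l * fx) with (l * fx + 0 * fx) by ring.
  replace (l * fy) with (l * fy + 0 * fy) by ring.
  apply (differentiable_pt_lim_comp (fun u _ => h u) f f); [ | exact Hf..].
  apply differentiable_pt_lim_proj1_0, is_derive_Reals, Hh.
Qed.

Lemma differentiable_pt_lim_const (c x y : R) :
  differentiable_pt_lim (fun _ _ => c) x y 0 0.
Proof.
  apply (differentiable_pt_lim_proj1_0 (fun _ => c)).
  apply derivable_pt_lim_const.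
Qed.

Lemma differentiable_pt_lim_fst (x y : R) :
  differentiable_pt_lim (fun u _ => u) x y 1 0.
Proof.
  apply (differentiable_pt_lim_proj1_0 (fun u => u)).
  apply derivable_pt_lim_id.
Qed.

Lemma differentiable_pt_lim_snd (x y : R) :
  differentiable_pt_lim (fun _ v => v) x y 0 1.
Proof.
  intros e; exists e; intros u v _ _.
  replace (v - y - _) with 0 by ring; rewrite Rabs_R0.
  apply Rmult_le_pos; [left; apply cond_pos | ].
  apply Rle_trans with (2 := Rmax_l _ _), Rabs_pos.
Qed.

Lemma differentiable_pt_lim_eq (f : R -> R -> R) (x y lx ly lx' ly' : R) :
  differentiable_pt_lim f x y lx ly -> lx = lx' -> ly = ly' ->
  differentiable_pt_lim f x y lx' ly'.
Proof. now intros H <- <-. Qed.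

(** Boundedness is part of the notion to make it stable under products. *)
Definition bounded_lipschitz (D : C -> Prop) (f : C -> R) : Prop :=
  exists B K : R, 0 <= B /\ 0 <= K /\
    (forall z, D z -> Rabs (f z) <= B) /\
    (forall z w, D z -> D w -> Rabs (f z - f w) <= K * Cmod (z - w)%C).

Lemma bounded_lipschitz_ext (D : C -> Prop) (f g : C -> R) :
  (forall z, f z = g z) -> bounded_lipschitz D f -> bounded_lipschitz D g.
Proof.
  intros Heq [B [K [HB [HK [Hf Hf']]]]].
  exists B, K; repeat split; auto; intros; rewrite <- !Heq; auto.
Qed.

Lemma bounded_lipschitz_const (D : C -> Prop) (c : R) :
  bounded_lipschitz D (fun _ => c).
Proof.
  exists (Rabs c), 0; repeat split; try apply Rabs_pos; try lra.
  - intros; apply Rle_refl.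
  - intros; rewrite Rminus_diag, Rabs_R0; lra.
Qed.

Lemma bounded_lipschitz_Re : bounded_lipschitz unit_box Re.
Proof.
  exists 1, 1; repeat split; try lra.
  - intros z Hz; apply Hz.
  - intros z w _ _; rewrite Rmult_1_l; apply (Re_le_Cmod (z - w)).
Qed.

Lemma bounded_lipschitz_Im : bounded_lipschitz unit_box Im.
Proof.
  exists 1, 1; repeat split; try lra.
  - intros z Hz; apply Hz.
  - intros z w _ _; rewrite Rmult_1_l; apply (Im_le_Cmod (z - w)).
Qed.

Lemma bounded_lipschitz_plus (D : C -> Prop) (f g : C -> R) :
  bounded_lipschitz D f -> bounded_lipschitz D g ->
  bounded_lipschitz D (fun z => f z + g z).
Proof.
  intros [B [K [HB [HK [Hf Hf']]]]] [B' [K' [HB' [HK' [Hg Hg']]]]].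
  exists (B + B'), (K + K'); repeat split; try lra.
  - intros z Hz; apply Rle_trans with (1 := Rabs_triang _ _).
    apply Rplus_le_compat; auto.
  - intros z w Hz Hw.
    replace (f z + g z - (f w + g w)) with ((f z - f w) + (g z - g w)) by ring.
    apply Rle_trans with (1 := Rabs_triang _ _).
    rewrite Rmult_plus_distr_r; apply Rplus_le_compat; auto.
Qed.

Lemma bounded_lipschitz_mult (D : C -> Prop) (f g : C -> R) :
  bounded_lipschitz D f -> bounded_lipschitz D g ->
  bounded_lipschitz D (fun z => f z * g z).
Proof.
  intros [B [K [HB [HK [Hf Hf']]]]] [B' [K' [HB' [HK' [Hg Hg']]]]].
  exists (B * B'), (K * B' + B * K'); repeat split; try nra.
  - intros z Hz; rewrite Rabs_mult.
    apply Rmult_le_compat; try apply Rabs_pos; auto.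
  - intros z w Hz Hw.
    replace (f z * g z - f w * g w)
      with ((f z - f w) * g z + f w * (g z - g w)) by ring.
    apply Rle_trans with (1 := Rabs_triang _ _); rewrite !Rabs_mult.
    replace ((K * B' + B * K') * Cmod (z - w)%C)
      with (K * Cmod (z - w)%C * B' + B * (K' * Cmod (z - w)%C)) by ring.
    apply Rplus_le_compat; apply Rmult_le_compat; try apply Rabs_pos; auto.
Qed.

Lemma bounded_lipschitz_pow (D : C -> Prop) (f : C -> R) (n : nat) :
  bounded_lipschitz D f -> bounded_lipschitz D (fun z => f z ^ n).
Proof.
  intros Hf; induction n as [ | n IH]; simpl.
  - apply bounded_lipschitz_const.
  - now apply bounded_lipschitz_mult.
Qed.

Lemma lipschitz_on_components (D : C -> Prop) (h : C -> C) :
  bounded_lipschitz D (fun z => Re (h z)) ->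
  bounded_lipschitz D (fun z => Im (h z)) -> lipschitz_on D h.
Proof.
  intros [_ [K [_ [_ [_ HX]]]]] [_ [K' [_ [_ [_ HY]]]]].
  exists (K + K'); intros z w Hz Hw.
  apply Rle_trans with (1 := Cmod_le_sum _).
  rewrite Rmult_plus_distr_r; apply Rplus_le_compat.
  - now apply HX.
  - now apply HY.
Qed.

(** * The radial polynomials of the reduced dynamics *)

(** The real and imaginary parts of the autonomous coefficient c(|z|^2) have
    this form, as functions of [s] = |z|^2. *)
Definition radial (M : nat) (c0 : R) (c : nat -> R) (s : R) : R :=
  c0 + sum_n_m (fun m => c m * s ^ m) 1 M.

Definition radial_deriv (M : nat) (c : nat -> R) (s : R) : R :=
  sum_n_m (fun m => c m * (INR m * s ^ pred m)) 1 M.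

Lemma sum_from_1_Sn (G : AbelianMonoid) (a : nat -> G) (M : nat) :
  sum_n_m a 1 (S M) = plus (sum_n_m a 1 M) (a (S M)).
Proof. apply sum_n_Sm; lia. Qed.

Lemma sum_from_1_0 (G : AbelianMonoid) (a : nat -> G) :
  sum_n_m a 1 0 = zero.
Proof. apply sum_n_m_zero; lia. Qed.

Lemma radial_0 (c0 : R) (c : nat -> R) (s : R) : radial 0 c0 c s = c0.
Proof. unfold radial; rewrite sum_from_1_0; apply Rplus_0_r. Qed.

Lemma radial_S (M : nat) (c0 : R) (c : nat -> R) (s : R) :
  radial (S M) c0 c s = radial M c0 c s + c (S M) * s ^ S M.
Proof. unfold radial; rewrite sum_from_1_Sn; symmetry; apply Rplus_assoc. Qed.

Lemma is_derive_radial (M : nat) (c0 : R) (c : nat -> R) (s : R) :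
  is_derive (radial M c0 c) s (radial_deriv M c s).
Proof.
  induction M as [ | M IH].
  - unfold radial_deriv; rewrite sum_from_1_0.
    apply (is_derive_ext (fun _ => c0)).
    { intros t; symmetry; apply radial_0. }
    apply @is_derive_const.
  - unfold radial_deriv; rewrite sum_from_1_Sn.
    apply (is_derive_ext (fun t => plus (radial M c0 c t) (c (S M) * t ^ S M))).
    { intros t; symmetry; apply radial_S. }
    apply @is_derive_plus; [exact IH | ].
    apply is_derive_scal.
    replace (INR (S M) * s ^ pred (S M))
      with (INR (S M) * 1 * s ^ pred (S M)) by ring.
    apply (is_derive_pow (fun t => t)), @is_derive_id.
Qed.

Lemma bounded_lipschitz_radial (M : nat) (c0 : R) (c : nat -> R)
    (D : C -> Prop) (f : C -> R) :
  bounded_lipschitz D f -> bounded_lipschitz D (fun z => radial M c0 c (f z)).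
Proof.
  intros Hf; induction M as [ | M IH].
  - apply bounded_lipschitz_ext with (fun _ => c0).
    { intros; symmetry; apply radial_0. }
    apply bounded_lipschitz_const.
  - apply bounded_lipschitz_ext
      with (fun z => radial M c0 c (f z) + c (S M) * f z ^ S M).
    { intros; symmetry; apply radial_S. }
    apply bounded_lipschitz_plus; [exact IH | ].
    apply bounded_lipschitz_mult; [apply bounded_lipschitz_const | ].
    now apply bounded_lipschitz_pow.
Qed.

Definition nsq (z : C) : R := Re z ^ 2 + Im z ^ 2.

Definition gain (M : nat) (lambda : C) (beta : nat -> C) (s : R) : C :=
  (radial M (Re lambda) (fun m => Re (beta m)) s,
   radial M (Im lambda) (fun m => Im (beta m)) s).

Lemma Cmult_conj_nsq (z : C) : (z * Cconj z = RtoC (nsq z))%C.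
Proof.
  destruct z as [x y]; apply injective_projections; unfold nsq; simpl; ring.
Qed.

Lemma reduced_field_gain (M : nat) (eps Omega : R) (lambda : C)
    (beta : nat -> C) (r t : R) (z : C) :
  reduced_field M eps Omega lambda beta r t z
  = (gain M lambda beta (nsq z) * z + (0, (eps * r)%R) * cis (Omega * t))%C.
Proof.
  unfold reduced_field; f_equal.
  2:{ f_equal; apply injective_projections; simpl; ring. }
  unfold gain; induction M as [ | M IH].
  - rewrite sum_from_1_0, !radial_0, <- surjective_pairing.
    apply Cplus_0_r.
  - rewrite sum_from_1_Sn, !radial_S.
    change (@plus C_AbelianMonoid) with Cplus.
    rewrite Cplus_assoc, IH.
    replace (beta (S M) * Cpow z (S M + 1) * Cpow (Cconj z) (S M))%C
      with (beta (S M) * RtoC (nsq z ^ S M) * z)%C.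
    + unfold Re, Im; apply injective_projections; simpl; ring.
    + rewrite RtoC_pow, <- Cmult_conj_nsq, Cpow_mult_l, Cpow_add_r.
      simpl; ring.
Qed.

Lemma a_fun_radial (M : nat) (lambda : C) (beta : nat -> C) (rho : R) :
  a_fun M lambda beta rho
  = rho * radial M (Re lambda) (fun m => Re (beta m)) (rho ^ 2).
Proof.
  unfold a_fun; induction M as [ | M IH].
  - rewrite sum_from_1_0, radial_0, Rplus_0_r; apply Rmult_comm.
  - rewrite sum_from_1_Sn, radial_S, Rmult_plus_distr_l, <- IH.
    rewrite <- pow_mult, pow_add, pow_1.
    change (@plus _) with Rplus; ring.
Qed.

Lemma b_fun_radial (M : nat) (lambda : C) (beta : nat -> C) (rho : R) :
  b_fun M lambda beta rho
  = radial M (Im lambda) (fun m => Im (beta m)) (rho ^ 2).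
Proof.
  unfold b_fun, radial; f_equal.
  apply sum_n_m_ext; intros m; now rewrite pow_mult.
Qed.

Lemma is_derive_a_fun (M : nat) (lambda : C) (beta : nat -> C) (rho : R) :
  is_derive (a_fun M lambda beta) rho
    (radial M (Re lambda) (fun m => Re (beta m)) (rho ^ 2)
     + 2 * rho ^ 2 * radial_deriv M (fun m => Re (beta m)) (rho ^ 2)).
Proof.
  set (h := radial M (Re lambda) (fun m => Re (beta m))).
  apply (is_derive_ext (fun x => x * h (x ^ 2))).
  { intros x; symmetry; apply a_fun_radial. }
  pose proof (is_derive_radial M (Re lambda) (fun m => Re (beta m)) (rho ^ 2))
    as H; fold h in H.
  auto_derive.
  - eexists; exact H.
  - change (rho * (rho * 1)) with (rho ^ 2).
    replace (Derive (fun s => h s) _)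
      with (radial_deriv M (fun m => Re (beta m)) (rho ^ 2)); [ring | ].
    symmetry; now apply is_derive_unique.
Qed.

Lemma is_derive_b_fun (M : nat) (lambda : C) (beta : nat -> C) (rho : R) :
  is_derive (b_fun M lambda beta) rho
    (2 * rho * radial_deriv M (fun m => Im (beta m)) (rho ^ 2)).
Proof.
  set (h := radial M (Im lambda) (fun m => Im (beta m))).
  apply (is_derive_ext (fun x => h (x ^ 2))).
  { intros x; symmetry; apply b_fun_radial. }
  pose proof (is_derive_radial M (Im lambda) (fun m => Im (beta m)) (rho ^ 2))
    as H; fold h in H.
  auto_derive.
  - eexists; exact H.
  - change (rho * (rho * 1)) with (rho ^ 2).
    replace (Derive (fun s => h s) _)
      with (radial_deriv M (fun m => Im (beta m)) (rho ^ 2)); [ring | ].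
    symmetry; now apply is_derive_unique.
Qed.

(** * The reduced dynamics in a rotating frame *)

Lemma cis_plus (x y : R) : cis (x + y) = (cis x * cis y)%C.
Proof.
  unfold cis; rewrite cos_plus, sin_plus.
  apply injective_projections; simpl; ring.
Qed.

Lemma cis_0 : cis 0 = 1%C.
Proof. unfold cis; now rewrite cos_0, sin_0. Qed.

Lemma cis_opp_r (x : R) : (cis x * cis (- x) = 1)%C.
Proof. now rewrite <- cis_plus, Rplus_opp_r, cis_0. Qed.

Lemma Cmod_cis (x : R) : Cmod (cis x) = 1.
Proof.
  unfold Cmod, cis; simpl fst; simpl snd.
  rewrite <- !Rsqr_pow2, Rplus_comm, sin2_cos2; apply sqrt_1.
Qed.

Lemma cis_2PI (x : R) : cis (x + 2 * PI) = cis x.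
Proof.
  unfold cis; now rewrite cos_plus, sin_plus, cos_2PI, sin_2PI,
    !Rmult_1_r, !Rmult_0_r, Rminus_0_r, Rplus_0_r.
Qed.

(** The autonomous part of the field commutes with rotations for this reason. *)
Lemma nsq_rotate (z : C) (x : R) : nsq (z * cis x)%C = nsq z.
Proof.
  unfold nsq; now rewrite <- !Cmod_sqr, Cmod_mult, Cmod_cis, Rmult_1_r.
Qed.

Lemma is_derive_rotate (w : R -> C) (theta : R -> R) (t omega : R) (l : C) :
  is_derive (V := C_R_NormedModule) w t l -> is_derive theta t omega ->
  is_derive (V := C_R_NormedModule) (fun s => w s * cis (theta s))%C t
    ((l + (0, omega) * w t) * cis (theta t))%C.
Proof.
  intros Hw Ht; apply is_derive_C_iff in Hw; destruct Hw as [H1 H2].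
  apply is_derive_C_iff; simpl.
  set (x := fun s => fst (w s)); set (y := fun s => snd (w s)).
  change (is_derive x t (fst l)) in H1; change (is_derive y t (snd l)) in H2.
  assert (Ex : Derive (fun s => x s) t = fst l) by now apply is_derive_unique.
  assert (Ey : Derive (fun s => y s) t = snd l) by now apply is_derive_unique.
  assert (Etheta : Derive (fun s => theta s) t = omega)
    by now apply is_derive_unique.
  change (fst (w t)) with (x t); change (snd (w t)) with (y t).
  split.
  - change (is_derive (fun s => x s * cos (theta s) - y s * sin (theta s)) t
      ((fst l + (0 * x t - omega * y t)) * cos (theta t)
       - (snd l + (0 * y t + omega * x t)) * sin (theta t))).
    auto_derive; [repeat split; eexists; eassumption | ].
    rewrite Ex, Ey, Etheta; ring.
  - change (is_derive (fun s => x s * sin (theta s) + y s * cos (theta s)) t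
      ((fst l + (0 * x t - omega * y t)) * sin (theta t)
       + (snd l + (0 * y t + omega * x t)) * cos (theta t))).
    auto_derive; [repeat split; eexists; eassumption | ].
    rewrite Ex, Ey, Etheta; ring.
Qed.

(** The converse of the product rule follows by rotating back. *)
Lemma is_derive_rotate_iff (w : R -> C) (theta : R -> R) (t omega : R)
    (l : C) :
  is_derive theta t omega ->
  is_derive (V := C_R_NormedModule) (fun s => w s * cis (theta s))%C t
    (l * cis (theta t))%C <->
  is_derive (V := C_R_NormedModule) w t (l - (0, omega) * w t)%C.
Proof.
  intros Ht; split; intros H.
  - assert (Ht' : is_derive (fun s => - theta s) t (- omega)).
    { now apply @is_derive_opp. }
    pose proof (is_derive_rotate _ _ _ _ _ H Ht') as H'.
    apply (is_derive_ext (V := C_R_NormedModule)) with (g := w) in H'.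
    2:{ intros s; rewrite <- Cmult_assoc, cis_opp_r; apply Cmult_1_r. }
    replace (l - (0, omega) * w t)%C
      with ((l * cis (theta t) + (0, (- omega)%R) * (w t * cis (theta t)))
            * cis (- theta t))%C; [exact H' | ].
    transitivity ((l + (0, (- omega)%R) * w t)
                  * (cis (theta t) * cis (- theta t)))%C; [ring | ].
    rewrite cis_opp_r; apply injective_projections; simpl; ring.
  - replace l with ((l - (0, omega) * w t) + (0, omega) * w t)%C by ring.
    now apply is_derive_rotate.
Qed.

(** The forcing i eps r e^{i Omega t} seen from the frame rotating by
    Omega t + psi, that is i eps r e^{- i psi}. *)
Definition forcing (eps r psi : R) : C :=
  (eps * r * sin psi, eps * r * cos psi).

(** The phase [psi] may vary: with constant phase this is the autonomous
    system around a response, with real [w] it is the polar system. *)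
Lemma reduced_field_rotating (M : nat) (eps Omega : R) (lambda : C)
    (beta : nat -> C) (r : R) (w : R -> C) (psi : R -> R) (t psi' : R) :
  is_derive psi t psi' ->
  let z := fun s => (w s * cis (Omega * s + psi s))%C in
  is_derive (V := C_R_NormedModule) z t
    (reduced_field M eps Omega lambda beta r t (z t)) <->
  is_derive (V := C_R_NormedModule) w t
    (gain M lambda beta (nsq (w t)) * w t + forcing eps r (psi t)
     - (0, (Omega + psi')%R) * w t)%C.
Proof.
  intros Hpsi z.
  replace (reduced_field M eps Omega lambda beta r t (z t))
    with ((gain M lambda beta (nsq (w t)) * w t + forcing eps r (psi t))
          * cis (Omega * t + psi t))%C.
  - apply is_derive_rotate_iff with (theta := fun s => Omega * s + psi s).
    apply (is_derive_plus (V := R_NormedModule)); [ | exact Hpsi].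
    auto_derive; [easy | ring].
  - rewrite reduced_field_gain; unfold z; rewrite nsq_rotate.
    replace (cis (Omega * t))
      with (cis (Omega * t + psi t) * cis (- psi t))%C
      by (rewrite <- cis_plus; f_equal; ring).
    replace (forcing eps r (psi t))
      with ((0, (eps * r)%R) * cis (- psi t))%C; [ring | ].
    unfold cis, forcing; rewrite cos_neg, sin_neg.
    apply injective_projections; simpl; ring.
Qed.

(** * Amplitude and phase of the periodic responses *)

Lemma nsq_RtoC (x : R) : nsq (RtoC x) = x ^ 2.
Proof. unfold nsq; simpl; ring. Qed.

Lemma is_derive_const_iff (c : C) (t : R) (l : C) :
  is_derive (V := C_R_NormedModule) (fun _ => c) t l <-> l = 0%C.
Proof.
  rewrite is_derive_C_iff; split.
  - intros [H1 H2]; apply is_derive_unique in H1, H2.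
    rewrite Derive_const in H1, H2.
    now apply injective_projections.
  - intros ->; split; apply @is_derive_const.
Qed.

Lemma periodic_response_iff (M : nat) (eps Omega T : R) (lambda : C)
    (beta : nat -> C) (r rho psi : R) :
  0 < Omega -> T = 2 * PI / Omega -> 0 < rho ->
  periodic_response (reduced_field M eps Omega lambda beta r) Omega T rho psi
  <->
  a_fun M lambda beta rho + eps * r * sin psi = 0 /\
  (b_fun M lambda beta rho - Omega) * rho + eps * r * cos psi = 0.
Proof.
  intros HOmega HT Hrho.
  assert (Hconst : forall t : R,
    is_derive (V := C_R_NormedModule) (response Omega rho psi) t
      (reduced_field M eps Omega lambda beta r t (response Omega rho psi t))
    <->
    a_fun M lambda beta rho + eps * r * sin psi = 0 /\
    (b_fun M lambda beta rho - Omega) * rho + eps * r * cos psi = 0).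
  { intros t.
    rewrite (reduced_field_rotating M eps Omega lambda beta r
      (fun _ => RtoC rho) (fun _ => psi) t 0) by apply @is_derive_const.
    rewrite is_derive_const_iff, nsq_RtoC, a_fun_radial, b_fun_radial.
    unfold gain, forcing.
    set (al := radial M (Re lambda) _ _); set (be := radial M (Im lambda) _ _).
    split.
    - intros H; injection H; intros; split; lra.
    - intros [H1 H2]; apply injective_projections; simpl; lra. }
  split.
  - intros [_ [H _]]; now apply (Hconst 0).
  - intros H; split; [exact Hrho | split; [intros t; now apply Hconst | ]].
    intros t; unfold response; f_equal.
    rewrite <- (cis_2PI (Omega * t + psi)); f_equal; rewrite HT; field; lra.
Qed.

(** The sign of the sine selects between acos c and - acos c. *)
Lemma unit_circle_angle (c s : R) :
  c ^ 2 + s ^ 2 = 1 -> exists psi : R, cos psi = c /\ sin psi = s.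
Proof.
  intros H.
  assert (Hc : -1 <= c <= 1) by nra.
  assert (Hsqrt : sqrt (1 - Rsqr c) = Rabs s).
  { rewrite <- sqrt_Rsqr_abs; f_equal; unfold Rsqr; lra. }
  destruct (Rle_dec 0 s) as [Hs | Hs].
  - exists (acos c); rewrite cos_acos, sin_acos by exact Hc.
    rewrite Hsqrt, Rabs_pos_eq by exact Hs; auto.
  - exists (- acos c); rewrite cos_neg, sin_neg, cos_acos, sin_acos by exact Hc.
    rewrite Hsqrt, Rabs_left by lra; split; ring.
Qed.

Lemma amplitude_equation (a b0 e : R) :
  e <> 0 ->
  (exists psi, a + e * sin psi = 0 /\ b0 + e * cos psi = 0) <->
  a ^ 2 + b0 ^ 2 = e ^ 2.
Proof.
  intros He; split.
  - intros [psi [H1 H2]].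
    replace a with (- (e * sin psi)) by lra.
    replace b0 with (- (e * cos psi)) by lra.
    pose proof (sin2_cos2 psi) as H; rewrite !Rsqr_pow2 in H.
    replace ((- (e * sin psi)) ^ 2 + (- (e * cos psi)) ^ 2)
      with (e ^ 2 * (sin psi ^ 2 + cos psi ^ 2)) by ring.
    rewrite H; ring.
  - intros H.
    destruct (unit_circle_angle (- b0 / e) (- a / e)) as [psi [Hc Hs]].
    { replace ((- b0 / e) ^ 2 + (- a / e) ^ 2)
        with ((a ^ 2 + b0 ^ 2) / e ^ 2) by (field; exact He).
      rewrite H; field; exact He. }
    exists psi; rewrite Hc, Hs; split; field; exact He.
Qed.

(** Equal cosines and sines give cos (x - y) = 1, so the sine of the half
    difference vanishes. *)
Lemma angle_eq_mod_2PI (x y : R) :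
  cos x = cos y -> sin x = sin y -> exists k : Z, x = y + 2 * IZR k * PI.
Proof.
  intros Hc Hs.
  assert (H : cos ((x - y) / 2) * cos ((x - y) / 2) = 1).
  { assert (Hd : cos (x - y) = 1).
    { rewrite cos_minus, Hc, Hs.
      pose proof (sin2_cos2 y) as H; unfold Rsqr in H; lra. }
    replace (x - y) with (2 * ((x - y) / 2)) in Hd by field.
    rewrite cos_2a_cos in Hd; lra. }
  assert (Hsin : sin ((x - y) / 2) = 0).
  { pose proof (sin2_cos2 ((x - y) / 2)) as H'; unfold Rsqr in H'; nra. }
  apply sin_eq_0_0 in Hsin; destruct Hsin as [k Hk].
  exists k; lra.
Qed.

(** * The planar system for amplitude and phase *)

(** With real [w] the imaginary part of the rotated equation has no derivative
    of [w] in it and determines the derivative of the phase. *)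
Lemma polar_system_reduced (M : nat) (eps Omega : R) (lambda : C)
    (beta : nat -> C) (r : R) :
  polar_system (reduced_field M eps Omega lambda beta r) Omega
    (fun rho psi => a_fun M lambda beta rho + eps * r * sin psi)
    (fun rho psi => b_fun M lambda beta rho - Omega + eps * r * cos psi / rho).
Proof.
  intros rho psi t Hpos [rho' Hrho] [psi' Hpsi] z.
  unfold z, response.
  rewrite (reduced_field_rotating M eps Omega lambda beta r
    (fun s => RtoC (rho s)) psi t psi' Hpsi).
  rewrite is_derive_C_iff, nsq_RtoC, a_fun_radial, b_fun_radial.
  unfold gain, forcing; simpl.
  set (al := radial M (Re lambda) _ _); set (be := radial M (Im lambda) _ _).
  replace (al * rho t - be * 0 + eps * r * sin (psi t)
           + - (0 * rho t - (Omega + psi') * 0))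
    with (rho t * al + eps * r * sin (psi t)) by ring.
  replace (al * 0 + be * rho t + eps * r * cos (psi t)
           + - (0 * 0 + (Omega + psi') * rho t))
    with ((be - Omega + eps * r * cos (psi t) / rho t - psi') * rho t)
    by (field; lra).
  split; intros [H1 H2]; (split; [exact H1 | ]).
  - apply is_derive_unique in H2; rewrite Derive_const in H2.
    symmetry in H2; apply Rmult_integral in H2.
    replace (be - Omega + eps * r * cos (psi t) / rho t) with psi' by lra.
    exact Hpsi.
  - apply is_derive_unique in H2; apply is_derive_unique in Hpsi.
    rewrite <- H2, Hpsi, Rminus_diag, Rmult_0_l; apply @is_derive_const.
Qed.

(** The partial derivatives with respect to the phase involve the forcing; the
    equilibrium equations express them by [a_fun] and [b_fun]. *)
Lemma is_jacobian_polar (M : nat) (eps Omega : R) (lambda : C)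
    (beta : nat -> C) (r rho psi : R) :
  rho <> 0 ->
  a_fun M lambda beta rho + eps * r * sin psi = 0 ->
  (b_fun M lambda beta rho - Omega) * rho + eps * r * cos psi = 0 ->
  is_jacobian
    (fun rho psi => a_fun M lambda beta rho + eps * r * sin psi)
    (fun rho psi => b_fun M lambda beta rho - Omega + eps * r * cos psi / rho)
    rho psi (J_mat M Omega lambda beta rho).
Proof.
  intros Hrho H1 H2.
  assert (Ha := is_derive_a_fun M lambda beta rho).
  assert (Hb := is_derive_b_fun M lambda beta rho).
  assert (Hsin : is_derive (fun x => eps * r * sin x) psi
                   (eps * r * cos psi)) by (auto_derive; [easy | ring]).
  assert (Hcos : is_derive (fun x => eps * r * cos x) psi
                   (- (eps * r * sin psi))) by (auto_derive; [easy | ring]).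
  assert (Hinv : is_derive Rinv rho (- / rho ^ 2)).
  { auto_derive; [exact Hrho | field; exact Hrho]. }
  assert (Hb' : is_derive (fun x => b_fun M lambda beta x - Omega) rho
                  (Derive (b_fun M lambda beta) rho)).
  { rewrite (is_derive_unique _ _ _ Hb).
    rewrite <- (Rminus_0_r (2 * rho * _)).
    apply (is_derive_minus (V := R_NormedModule)); [exact Hb | ].
    apply @is_derive_const. }
  rewrite <- (is_derive_unique _ _ _ Ha) in Ha.
  split; unfold J_mat, coeff_mat; simpl.
  - eapply differentiable_pt_lim_eq.
    + apply differentiable_pt_lim_plus.
      * eapply (differentiable_pt_lim_comp_1 (a_fun M lambda beta)
          (fun u _ => u) _ _ _ _ _ Ha).
        apply differentiable_pt_lim_fst.
      * eapply (differentiable_pt_lim_comp_1 (fun x => eps * r * sin x)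
          (fun _ v => v) _ _ _ _ _ Hsin).
        apply differentiable_pt_lim_snd.
    + simpl; ring.
    + lra.
  - eapply differentiable_pt_lim_eq.
    + apply differentiable_pt_lim_plus.
      * eapply (differentiable_pt_lim_comp_1
          (fun x => b_fun M lambda beta x - Omega) (fun u _ => u)
          _ _ _ _ _ Hb').
        apply differentiable_pt_lim_fst.
      * apply differentiable_pt_lim_mult.
        -- eapply (differentiable_pt_lim_comp_1 (fun x => eps * r * cos x)
             (fun _ v => v) _ _ _ _ _ Hcos).
           apply differentiable_pt_lim_snd.
        -- eapply (differentiable_pt_lim_comp_1 Rinv (fun u _ => u)
             _ _ _ _ _ Hinv).
           apply differentiable_pt_lim_fst.
    + cbv beta.
      replace (eps * r * cos psi) with ((Omega - b_fun M lambda beta rho) * rho)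
        by lra; field; exact Hrho.
    + cbv beta.
      replace (eps * r * sin psi) with (- a_fun M lambda beta rho) by lra.
      field; exact Hrho.
Qed.

(** * The reduced dynamics around a periodic response *)

(** Real part of the field in the coordinate u = x + i y, w = rho + u. *)
Definition frame_X (M : nat) (eps : R) (Omega : R) (lambda : C)
    (beta : nat -> C) (r rho psi x y : R) : R :=
  radial M (Re lambda) (fun m => Re (beta m)) ((rho + x) ^ 2 + y ^ 2)
    * (rho + x)
  + (-1) * ((radial M (Im lambda) (fun m => Im (beta m))
               ((rho + x) ^ 2 + y ^ 2) + - Omega) * y)
  + eps * r * sin psi.

Definition frame_Y (M : nat) (eps : R) (Omega : R) (lambda : C)
    (beta : nat -> C) (r rho psi x y : R) : R :=
  radial M (Re lambda) (fun m => Re (beta m)) ((rho + x) ^ 2 + y ^ 2) * y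
  + (radial M (Im lambda) (fun m => Im (beta m)) ((rho + x) ^ 2 + y ^ 2)
     + - Omega) * (rho + x)
  + eps * r * cos psi.

Lemma is_derive_shift_iff (c : C) (u : R -> C) (t : R) (l : C) :
  is_derive (V := C_R_NormedModule) (fun s => c + u s)%C t l <->
  is_derive (V := C_R_NormedModule) u t l.
Proof.
  assert (H : forall (c : C) (u : R -> C),
    is_derive (V := C_R_NormedModule) u t l ->
    is_derive (V := C_R_NormedModule) (fun s => c + u s)%C t l).
  { intros d v Hv; rewrite <- (Cplus_0_l l).
    apply (is_derive_plus (V := C_R_NormedModule) (fun _ => d) v t (RtoC 0) l);
      [ | exact Hv].
    now apply is_derive_const_iff. }
  split; intros Hu; [ | now apply H].
  apply (is_derive_ext (V := C_R_NormedModule) (fun s => - c + (c + u s))%C).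
  { intros s; change (- c + (c + u s) = u s)%C; ring. }
  now apply H.
Qed.

Lemma solution_frame_iff (M : nat) (eps Omega : R) (lambda : C)
    (beta : nat -> C) (r rho psi t : R) (u : R -> C) :
  let z := fun s => ((rho + u s) * cis (Omega * s + psi))%C in
  is_derive (V := C_R_NormedModule) z t
    (reduced_field M eps Omega lambda beta r t (z t)) <->
  is_derive (V := C_R_NormedModule) u t
    (planar (frame_X M eps Omega lambda beta r rho psi)
       (frame_Y M eps Omega lambda beta r rho psi) t (u t)).
Proof.
  intros z; unfold z.
  rewrite (reduced_field_rotating M eps Omega lambda beta r
    (fun s => RtoC rho + u s)%C (fun _ => psi) t 0) by apply @is_derive_const.
  rewrite is_derive_shift_iff.
  match goal with |- is_derive _ _ ?a <-> is_derive _ _ ?b =>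
    replace a with b; [reflexivity | ] end.
  assert (Hn : nsq (rho + u t)%C = (rho + Re (u t)) ^ 2 + Im (u t) ^ 2).
  { unfold nsq; simpl; unfold Re, Im; ring. }
  rewrite Hn; unfold planar, frame_X, frame_Y, gain, forcing.
  set (al := radial M (Re lambda) _ _); set (be := radial M (Im lambda) _ _).
  apply injective_projections; simpl; unfold Re, Im; ring.
Qed.

(** At u = 0 the squared modulus |rho + u|^2 changes by 2 rho dx, so only the
    first column contains derivatives of the radial polynomials. *)
Lemma is_jacobian_frame (M : nat) (eps Omega : R) (lambda : C)
    (beta : nat -> C) (r rho psi : R) :
  is_jacobian (frame_X M eps Omega lambda beta r rho psi)
    (frame_Y M eps Omega lambda beta r rho psi) 0 0
    (mat2
      (radial M (Re lambda) (fun m => Re (beta m)) (rho ^ 2)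
       + 2 * rho ^ 2 * radial_deriv M (fun m => Re (beta m)) (rho ^ 2))
      (Omega - b_fun M lambda beta rho)
      (2 * rho ^ 2 * radial_deriv M (fun m => Im (beta m)) (rho ^ 2)
       + b_fun M lambda beta rho - Omega)
      (radial M (Re lambda) (fun m => Re (beta m)) (rho ^ 2))).
Proof.
  assert (Hx : differentiable_pt_lim (fun x _ => rho + x) 0 0 1 0).
  { eapply differentiable_pt_lim_eq;
      [apply differentiable_pt_lim_plus;
         [apply differentiable_pt_lim_const | apply differentiable_pt_lim_fst]
      | ring..]. }
  assert (Hs : differentiable_pt_lim (fun x y => (rho + x) ^ 2 + y ^ 2) 0 0
                 (2 * rho) 0).
  { assert (Hsq : forall x, is_derive (fun x => x ^ 2) x (2 * x)).
    { intros; auto_derive; [easy | ring]. }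
    eapply differentiable_pt_lim_eq.
    - apply differentiable_pt_lim_plus.
      + eapply (differentiable_pt_lim_comp_1 (fun x => x ^ 2)
          (fun x _ => rho + x) _ _ _ _ _ (Hsq _) Hx).
      + eapply (differentiable_pt_lim_comp_1 (fun x => x ^ 2)
          (fun _ y => y) _ _ _ _ _ (Hsq _)), differentiable_pt_lim_snd.
    - ring.
    - ring. }
  assert (Hr : forall c0 c, differentiable_pt_lim
      (fun x y => radial M c0 c ((rho + x) ^ 2 + y ^ 2)) 0 0
      (radial_deriv M c (rho ^ 2) * (2 * rho))
      (radial_deriv M c (rho ^ 2) * 0)).
  { intros c0 c.
    eapply (differentiable_pt_lim_comp_1 (radial M c0 c)
      (fun x y => (rho + x) ^ 2 + y ^ 2)); [ | exact Hs].
    replace ((rho + 0) ^ 2 + 0 ^ 2) with (rho ^ 2) by ring.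
    apply is_derive_radial. }
  rewrite b_fun_radial.
  assert (H0 : (rho + 0) ^ 2 + 0 ^ 2 = rho ^ 2) by ring.
  split; unfold mat2, coeff_mat; simpl coeff_Tn; unfold frame_X, frame_Y.
  - eapply differentiable_pt_lim_eq.
    + repeat first
        [ apply differentiable_pt_lim_const | apply Hr | apply Hx
        | apply differentiable_pt_lim_snd
        | apply (differentiable_pt_lim_plus (fun x y => _ * _)
            (fun x y => _ * _))
        | apply differentiable_pt_lim_mult
        | apply differentiable_pt_lim_plus ].
    + cbv beta; rewrite ?H0; simpl; ring.
    + cbv beta; rewrite ?H0; simpl; ring.
  - eapply differentiable_pt_lim_eq.
    + repeat first
        [ apply differentiable_pt_lim_const | apply Hr | apply Hx
        | apply differentiable_pt_lim_snd
        | apply differentiable_pt_lim_mult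
        | apply differentiable_pt_lim_plus ].
    + cbv beta; rewrite ?H0; simpl; ring.
    + cbv beta; rewrite ?H0; simpl; ring.
Qed.

Lemma lipschitz_frame (M : nat) (eps Omega : R) (lambda : C)
    (beta : nat -> C) (r rho psi : R) :
  lipschitz_on unit_box
    (planar (frame_X M eps Omega lambda beta r rho psi)
       (frame_Y M eps Omega lambda beta r rho psi) 0).
Proof.
  assert (Hx : bounded_lipschitz unit_box (fun z => rho + Re z)).
  { apply bounded_lipschitz_plus;
      [apply bounded_lipschitz_const | apply bounded_lipschitz_Re]. }
  assert (Hs : bounded_lipschitz unit_box
                 (fun z => (rho + Re z) ^ 2 + Im z ^ 2)).
  { apply bounded_lipschitz_plus; apply bounded_lipschitz_pow;
      [exact Hx | apply bounded_lipschitz_Im]. }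
  assert (Hr : forall c0 c, bounded_lipschitz unit_box
                 (fun z => radial M c0 c ((rho + Re z) ^ 2 + Im z ^ 2))).
  { intros; now apply bounded_lipschitz_radial. }
  apply lipschitz_on_components; unfold planar, frame_X, frame_Y; simpl Re;
    simpl Im;
    repeat first
      [ apply bounded_lipschitz_const | apply Hr | apply Hx
      | apply bounded_lipschitz_Im
      | apply bounded_lipschitz_mult | apply bounded_lipschitz_plus ].
Qed.

Lemma response_frame_distance (Omega rho psi t : R) (w : C) :
  Cmod ((rho + w) * cis (Omega * t + psi) - response Omega rho psi t)%C
  = Cmod w.
Proof.
  unfold response.
  replace ((rho + w) * cis (Omega * t + psi) - rho * cis (Omega * t + psi))%C
    with (w * cis (Omega * t + psi))%C by ring.
  now rewrite Cmod_mult, Cmod_cis, Rmult_1_r.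
Qed.

(** The deviation from the response as seen in its own rotating frame. *)
Definition to_frame (Omega rho psi : R) (z : R -> C) (t : R) : C :=
  (z t * cis (- (Omega * t + psi)) - rho)%C.

Definition of_frame (Omega rho psi : R) (u : R -> C) (t : R) : C :=
  ((rho + u t) * cis (Omega * t + psi))%C.

Lemma of_to_frame (Omega rho psi : R) (z : R -> C) (t : R) :
  of_frame Omega rho psi (to_frame Omega rho psi z) t = z t.
Proof.
  unfold of_frame, to_frame.
  transitivity (z t * (cis (Omega * t + psi) * cis (- (Omega * t + psi))))%C.
  - ring.
  - rewrite cis_opp_r; ring.
Qed.

Definition frame_conjugates (g : R -> C -> C) (X Y : R -> R -> R)
    (Omega rho psi : R) : Prop :=
  forall (u : R -> C) (t : R),
    is_derive (V := C_R_NormedModule) (of_frame Omega rho psi u) t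
      (g t (of_frame Omega rho psi u t)) <->
    is_derive (V := C_R_NormedModule) u t (planar X Y t (u t)).

Lemma solution_on_to_frame (g : R -> C -> C) (X Y : R -> R -> R)
    (Omega rho psi : R) (z : R -> C) (t0 : R) (t1 : Rbar) :
  frame_conjugates g X Y Omega rho psi ->
  solution_on g z t0 t1 ->
  solution_on (planar X Y) (to_frame Omega rho psi z) t0 t1.
Proof.
  intros Hframe Hz t Ht0 Ht1; apply Hframe; rewrite of_to_frame.
  apply (is_derive_ext (V := C_R_NormedModule) z).
  { intros s; symmetry; apply of_to_frame. }
  now apply Hz.
Qed.

Lemma distance_to_frame (Omega rho psi : R) (z : R -> C) (t : R) :
  Cmod (z t - response Omega rho psi t)%C
  = Cmod (to_frame Omega rho psi z t - 0)%C.
Proof.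
  rewrite Cminus_0_r.
  rewrite <- (response_frame_distance Omega rho psi t (to_frame _ _ _ z t)).
  do 2 f_equal; symmetry; apply of_to_frame.
Qed.

Lemma asymptotically_stable_of_frame (g : R -> C -> C) (X Y : R -> R -> R)
    (Omega rho psi : R) :
  frame_conjugates g X Y Omega rho psi ->
  asymptotically_stable (planar X Y) (fun _ => 0%C) ->
  asymptotically_stable g (response Omega rho psi).
Proof.
  intros Hframe [Hst Has]; split.
  - intros t0 e; destruct (Hst t0 e) as [d Hd]; exists d.
    intros z t1 Hz Hz0 t Ht; rewrite distance_to_frame in *.
    apply (Hd _ t1); [ | exact Hz0 | exact Ht].
    now apply solution_on_to_frame with (1 := Hframe).
  - intros t0; destruct (Has t0) as [d Hd]; exists d.
    intros z Hz Hz0; rewrite distance_to_frame in Hz0.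
    eapply is_lim_ext.
    { intros t; symmetry; apply distance_to_frame. }
    apply Hd; [now apply solution_on_to_frame with (1 := Hframe) | exact Hz0].
Qed.

Lemma lyapunov_stable_to_frame (g : R -> C -> C) (X Y : R -> R -> R)
    (Omega rho psi : R) :
  frame_conjugates g X Y Omega rho psi ->
  lyapunov_stable g (response Omega rho psi) ->
  lyapunov_stable (planar X Y) (fun _ => 0%C).
Proof.
  intros Hframe Hst t0 e; destruct (Hst t0 e) as [d Hd]; exists d.
  intros u t1 Hu Hu0 t Ht; rewrite Cminus_0_r in *.
  rewrite <- (response_frame_distance Omega rho psi t (u t)).
  rewrite <- (response_frame_distance Omega rho psi t0 (u t0)) in Hu0.
  apply (Hd (of_frame Omega rho psi u) t1); [ | exact Hu0 | exact Ht].
  intros s Hs0 Hs1; apply Hframe; now apply Hu.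
Qed.

(** * Amplitude, phase shift and stability of the periodic responses *)

Theorem theorem3p2 (M : nat) (eps Omega T : R) (lambda : C) (beta : nat -> C)
    (r : R) (hM : (1 <= M)%nat) (heps : 0 < eps) (hOmega : 0 < Omega)
    (hT : T = 2 * PI / Omega) (hlambda : Re lambda < 0 < Im lambda)
    (hr : r <> 0) :
  let g := reduced_field M eps Omega lambda beta r in
  let a := a_fun M lambda beta in
  let b := b_fun M lambda beta in
  let f := f_fun M eps lambda beta r in
  let J := J_mat M Omega lambda beta in
  (* (i) *)
  (forall rho : R, 0 < rho ->
     ((exists psi : R, periodic_response g Omega T rho psi)
      <-> f rho Omega = 0))
  /\
  (* (ii) the phase is an angle, so it is determined modulo 2 PI; the sign of
     a rho * r selects the branch of the two-valued inverse cosine *)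
  (forall rho psi : R, periodic_response g Omega T rho psi ->
     let c := (Omega - b rho) * rho / (eps * r) in
     -1 <= c <= 1 /\
     (a rho * r <= 0 -> exists k : Z, psi = acos c + 2 * IZR k * PI) /\
     (0 <= a rho * r -> exists k : Z, psi = - acos c + 2 * IZR k * PI))
  /\
  (* (iii) *)
  (exists F G : R -> R -> R,
     polar_system g Omega F G /\
     (forall rho psi : R, 0 < rho ->
        (periodic_response g Omega T rho psi
         <-> F rho psi = 0 /\ G rho psi = 0)) /\
     (forall rho psi : R, periodic_response g Omega T rho psi ->
        is_jacobian F G rho psi (J rho)))
  /\
  (forall rho psi : R, periodic_response g Omega T rho psi ->
     ((forall mu : C, is_eigenvalue (J rho) mu -> Re mu < 0) ->
        asymptotically_stable g (response Omega rho psi)) /\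
     ((exists mu : C, is_eigenvalue (J rho) mu /\ 0 < Re mu) ->
        ~ lyapunov_stable g (response Omega rho psi))).
Proof.
  intros g a b f J.
  assert (Hper : forall rho psi, 0 < rho ->
    (periodic_response g Omega T rho psi <->
     a rho + eps * r * sin psi = 0 /\
     (b rho - Omega) * rho + eps * r * cos psi = 0)).
  { intros rho psi Hrho; now apply periodic_response_iff. }
  assert (Her : eps * r <> 0).
  { apply Rmult_integral_contrapositive; split; [lra | exact hr]. }
  split; [ | split; [ | split]].
  - intros rho Hrho.
    transitivity (exists psi, a rho + eps * r * sin psi = 0 /\
                    (b rho - Omega) * rho + eps * r * cos psi = 0).
    { split; intros [psi H]; exists psi; now apply Hper. }
    rewrite amplitude_equation by exact Her.
    unfold f, f_fun; fold a b.
    rewrite !Rpow_mult_distr; split; lra.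
  - intros rho psi H c.
    assert (Hrho : 0 < rho) by apply H.
    apply Hper in H; [ | exact Hrho]; destruct H as [H1 H2].
    assert (Hcos : cos psi = c).
    { unfold c; replace ((Omega - b rho) * rho) with (eps * r * cos psi) by lra.
      field; split; [exact hr | lra]. }
    assert (Hc : -1 <= c <= 1) by (rewrite <- Hcos; apply COS_bound).
    assert (Hsqrt : sqrt (1 - Rsqr c) = Rabs (sin psi)).
    { rewrite <- Hcos, <- sqrt_Rsqr_abs; f_equal.
      pose proof (sin2_cos2 psi); lra. }
    (* sin psi and a(rho) r have opposite signs *)
    assert (Har : a rho * r = - (eps * r ^ 2) * sin psi).
    { replace (a rho) with (- (eps * r * sin psi)) by lra; ring. }
    assert (Hpos : 0 < eps * r ^ 2).
    { apply Rmult_lt_0_compat; [exact heps | now apply pow2_gt_0]. }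
    split; [exact Hc | split; intros Hsign; apply angle_eq_mod_2PI].
    + now rewrite cos_acos.
    + rewrite sin_acos, Hsqrt, Rabs_pos_eq by (exact Hc || nra); reflexivity.
    + now rewrite cos_neg, cos_acos.
    + rewrite sin_neg, sin_acos, Hsqrt by exact Hc.
      rewrite Rabs_left1 by nra; ring.
  - exists (fun rho psi => a rho + eps * r * sin psi),
      (fun rho psi => b rho - Omega + eps * r * cos psi / rho).
    split; [apply polar_system_reduced | split].
    + intros rho psi Hrho; rewrite (Hper rho psi Hrho).
      replace ((b rho - Omega) * rho + eps * r * cos psi)
        with ((b rho - Omega + eps * r * cos psi / rho) * rho)
        by (field; lra).
      split; intros [H1 H2]; (split; [exact H1 | ]).
      * apply Rmult_integral in H2; destruct H2; [assumption | lra].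
      * rewrite H2; ring.
    + intros rho psi H.
      assert (Hrho : 0 < rho) by apply H.
      apply Hper in H; [ | exact Hrho]; destruct H as [H1 H2].
      apply is_jacobian_polar; [lra | exact H1 | exact H2].
  - intros rho psi H.
    assert (Hrho : 0 < rho) by apply H.
    apply Hper in H; [ | exact Hrho]; destruct H as [H1 H2].
    set (X := frame_X M eps Omega lambda beta r rho psi).
    set (Y := frame_Y M eps Omega lambda beta r rho psi).
    assert (HA := is_jacobian_frame M eps Omega lambda beta r rho psi).
    fold X Y b in HA.
    assert (Hb0 : b rho = radial M (Im lambda) (fun m => Im (beta m))
                            ((rho + 0) ^ 2 + 0 ^ 2)).
    { unfold b; rewrite b_fun_radial; f_equal; ring. }
    assert (Ha0 : a rho = rho * radial M (Re lambda) (fun m => Re (beta m))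
                            ((rho + 0) ^ 2 + 0 ^ 2)).
    { unfold a; rewrite a_fun_radial; do 2 f_equal; ring. }
    assert (HX0 : X 0 0 = 0) by (unfold X, frame_X; rewrite <- Hb0; lra).
    assert (HY0 : Y 0 0 = 0) by (unfold Y, frame_Y; rewrite <- Hb0; lra).
    assert (Hframe : frame_conjugates g X Y Omega rho psi).
    { intros u t; apply solution_frame_iff. }
    assert (HDa : Derive a rho = _)
      by (apply is_derive_unique, is_derive_a_fun).
    assert (HDb : Derive b rho = _)
      by (apply is_derive_unique, is_derive_b_fun).
    replace (rho ^ 2) with ((rho + 0) ^ 2 + 0 ^ 2) in HA, HDa, HDb by ring.
    set (al := radial M (Re lambda) _ _) in HA, HDa, Ha0.
    set (dal := radial_deriv M _ _) in HA, HDa.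
    set (dbe := radial_deriv M _ _) in HA, HDb.
    assert (HJ : J rho = mat2 (Derive a rho) ((Omega - b rho) * rho)
      (Derive b rho - (Omega - b rho) / rho) (a rho / rho)) by reflexivity.
    assert (Hal : a rho / rho = al) by (rewrite Ha0; field; lra).
    rewrite HJ, Hal, HDa, HDb; clear HJ.
    set (p := al + _) in HA |- *.
    set (s := 2 * _ * dbe + _ - Omega) in HA.
    (* the two Jacobians are conjugate by diag(1, rho): same determinant *)
    assert (Hdet : p * al - (Omega - b rho) * s
      = p * al - (Omega - b rho) * rho
                 * (2 * rho * dbe - (Omega - b rho) / rho)).
    { unfold s; field; lra. }
    split.
    + intros Hneg; apply hurwitz_trace_det in Hneg.
      destruct Hneg as [Htr Hdet'].
      apply (asymptotically_stable_of_frame g X Y Omega rho psi Hframe).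
      apply (planar_asymptotically_stable _ _ _ _ _ _ HX0 HY0 HA).
      * exact Htr.
      * rewrite Hdet; exact Hdet'.
    + intros [mu [Hmu Hpos]] Hst.
      destruct (unstable_eigenvalue_shift _ _ _ _ _ Hmu Hpos) as [k [Hk Hc]].
      apply (lyapunov_stable_to_frame g X Y Omega rho psi Hframe) in Hst.
      revert Hst.
      apply (planar_unstable _ _ _ _ _ _ k HX0 HY0 HA); [ | exact Hk | ].
      * apply lipschitz_frame.
      * rewrite <- Hdet in Hc.
        replace (_ * _) with
          ((p + al - 2 * k)
           * (p * al - (Omega - b rho) * s - k * (p + al) + k ^ 2)) by ring.
        exact Hc.
Qed.
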